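(* Let $G\subset \mathrm{PSL}(2,\mathbb{R})$ be a non uniform lattice. For any cusp $e$ of $G$, the Lagrange spectrum $\mathcal{L}(G,e)$ of $G$ with respect to $e$ contains a Hall ray, i.e. there exists $r\in\mathbb{R}$ such that $[r,+\infty]\subset\mathcal{L}(G,e)$.
   Context: $\mathrm{PSL}(2,\mathbb{R})$ acts by Möbius transformations on the upper half-plane $\mathbb{H}$ and on its boundary $\overline{\mathbb{R}}=\mathbb{R}\cup\{\infty\}$. A non uniform lattice is a discrete subgroup $G\subset\mathrm{PSL}(2,\mathbb{R})$ such that $G\backslash\mathbb{H}$ has finite hyperbolic area but is not compact. A cusp of $G$ is a point of $\overline{\mathbb{R}}$ fixed by a non-trivial parabolic element of $G$. If $\infty$ is a cusp of a non uniform lattice $G$: for $g\in G$ let $a(g)$ and $c(g)$ be the first entries of the first and second row of a matrix representing $g$. For $\alpha\in\mathbb{R}$ let $L_G(\alpha)\in[0,+\infty]$ be the supremum (in $[0,+\infty]$) of the $k>0$ such that $|\alpha-g\cdot\infty|=|\alpha-\frac{a(g)}{c(g)}|<\frac{1}{k\,c(g)^2}$ for infinitely many $g\in G$ whose images $g\cdot\infty$ are all distinct. Put $\mathcal{L}(G,\infty):=\{L_G(\alpha):\alpha\in\mathbb{R}\}$. For a general cusp $e$ of $G$, choose an element $g_0\in\mathrm{PSL}(2,\mathbb{R})$ with $g_0\cdot e=\infty$ (a normalization) and set $\mathcal{L}(G,e):=\mathcal{L}(g_0Gg_0^{-1},\infty)$. Different choices of $g_0$ change the spectrum only by multiplication by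 a positive constant, so that the presence of a Hall ray does not depend on the choice. *)

(* Defs.v *)
From HB Require Import structures.
From mathcomp Require Import all_boot all_order all_algebra.
From mathcomp Require Import all_classical all_reals all_analysis.

Set Implicit Arguments.
Unset Strict Implicit.
Unset Printing Implicit Defensive.
Import Order.TTheory GRing.Theory Num.Theory.
Import numFieldNormedType.Exports.

Local Open Scope classical_set_scope.
Local Open Scope ring_scope.
Local Open Scope quotient_scope.

Record SL2 (R : realType) := MkSL2 {
  SL2_mx :> 'M[R]_2;
  det_SL2b : \det SL2_mx == 1 }.

HB.instance Definition _ (R : realType) := [isSub for @SL2_mx R].
HB.instance Definition _ (R : realType) := [Choice of SL2 R by <:].
HB.instance Definition _ (R : realType) :=
  Topological.copy (SL2 R) (initial_topology (@SL2_mx R)).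

Section SL2_theory.
Variable R : realType.
Implicit Types M N : SL2 R.

Lemma det_SL2 M : \det M = 1.
Proof. exact/eqP/det_SL2b. Qed.

Lemma unit_SL2 M : (M : 'M[R]_2) \is a GRing.unit.
Proof. by change (SL2_mx M \in unitmx); rewrite unitmxE det_SL2 unitr1. Qed.

Fact SL2_one_subproof : \det (1 : 'M[R]_2) == 1.
Proof. by rewrite det1. Qed.
Definition SL2_one : SL2 R := MkSL2 SL2_one_subproof.

Fact SL2_mul_subproof M N : \det (SL2_mx M * SL2_mx N) == 1.
Proof. by rewrite det_mulmx !det_SL2 mulr1. Qed.
Definition SL2_mul M N : SL2 R := MkSL2 (SL2_mul_subproof M N).

Fact SL2_inv_subproof M : \det (SL2_mx M)^-1 == 1.
Proof.
by change (\det (invmx (SL2_mx M)) == 1); rewrite det_inv det_SL2 invr1.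
Qed.
Definition SL2_inv M : SL2 R := MkSL2 (SL2_inv_subproof M).

Definition SL2_pm : rel (SL2 R) :=
  fun M N => (SL2_mx M == SL2_mx N) || (SL2_mx M == - SL2_mx N).

Lemma SL2_pm_equiv : equiv_class_of SL2_pm.
Proof.
split=> [M|M N|N M P]; rewrite /SL2_pm.
- by rewrite eqxx.
- by rewrite eq_sym; congr (_ || _); rewrite eq_sym eqr_oppLR.
- by move=> /orP[]/eqP-> /orP[]/eqP->; rewrite ?opprK eqxx ?orbT.
Qed.

Canonical SL2_pm_equiv_rel := EquivRelPack SL2_pm_equiv.

End SL2_theory.

(* SL(2,R)/{1,-1} with the quotient topology. For g : PSL2 R, [repr g] is one
   of the two matrices representing g; the lemmas PSL2_mul_pi, PSL2_inv_pi,
   PSL2_act_pi and PSL2_bd_pi show that the operations below do not depend on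
   this choice. *)
Definition PSL2 (R : realType) : Type :=
  quotient_topology {eq_quot (@SL2_pm R)}.

HB.instance Definition _ (R : realType) := Quotient.on (PSL2 R).
HB.instance Definition _ (R : realType) := Topological.on (PSL2 R).

Section PSL2_group.
Variable R : realType.
Implicit Types (g h : PSL2 R) (M N : SL2 R).

Lemma PSL2_piP M N : \pi_(PSL2 R) M = \pi_(PSL2 R) N <-> SL2_pm M N.
Proof. exact: rwP (@eqmodP _ (@SL2_pm_equiv_rel R) M N). Qed.

Lemma repr_piP M : SL2_pm (repr (\pi_(PSL2 R) M)) M.
Proof. by apply/PSL2_piP; rewrite reprK. Qed.

Definition PSL2_one : PSL2 R := \pi_(PSL2 R) (SL2_one R).
Definition PSL2_mul g h : PSL2 R := \pi_(PSL2 R) (SL2_mul (repr g) (repr h)).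
Definition PSL2_inv g : PSL2 R := \pi_(PSL2 R) (SL2_inv (repr g)).

Lemma PSL2_mul_pi M N :
  PSL2_mul (\pi_(PSL2 R) M) (\pi_(PSL2 R) N) = \pi_(PSL2 R) (SL2_mul M N).
Proof.
apply/PSL2_piP; rewrite /SL2_pm /=.
by case/orP: (repr_piP M) => /eqP->; case/orP: (repr_piP N) => /eqP->;
  rewrite ?(mulrN, mulNr, opprK) eqxx ?orbT.
Qed.

Lemma PSL2_inv_pi M : PSL2_inv (\pi_(PSL2 R) M) = \pi_(PSL2 R) (SL2_inv M).
Proof.
apply/PSL2_piP; rewrite /SL2_pm /=.
by case/orP: (repr_piP M) => /eqP->; rewrite ?invrN eqxx ?orbT.
Qed.

Fact PSL2_mulA : associative PSL2_mul.
Proof.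
move=> g h k; elim/quotW: g => M; elim/quotW: h => N; elim/quotW: k => P.
rewrite (PSL2_mul_pi N) (PSL2_mul_pi M N) !PSL2_mul_pi.
by apply/PSL2_piP; rewrite /SL2_pm /= mulrA eqxx.
Qed.

Fact PSL2_mul1 : left_id PSL2_one PSL2_mul.
Proof.
move=> g; elim/quotW: g => M; rewrite PSL2_mul_pi.
by apply/PSL2_piP; rewrite /SL2_pm /= mul1r eqxx.
Qed.

Fact PSL2_mulr1 : right_id PSL2_one PSL2_mul.
Proof.
move=> g; elim/quotW: g => M; rewrite PSL2_mul_pi.
by apply/PSL2_piP; rewrite /SL2_pm /= mulr1 eqxx.
Qed.

Fact PSL2_mulV : left_inverse PSL2_one PSL2_inv PSL2_mul.
Proof.
move=> g; elim/quotW: g => M; rewrite PSL2_inv_pi PSL2_mul_pi.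
by apply/PSL2_piP; rewrite /SL2_pm /= mulVr ?unit_SL2 ?eqxx.
Qed.

Fact PSL2_mulrV : right_inverse PSL2_one PSL2_inv PSL2_mul.
Proof.
move=> g; elim/quotW: g => M; rewrite PSL2_inv_pi PSL2_mul_pi.
by apply/PSL2_piP; rewrite /SL2_pm /= mulrV ?unit_SL2 ?eqxx.
Qed.

End PSL2_group.

HB.instance Definition _ (R : realType) :=
  isGroup.Build (PSL2 R) (@PSL2_mulA R) (@PSL2_mul1 R) (@PSL2_mulr1 R)
    (@PSL2_mulV R) (@PSL2_mulrV R).

Record UHP (R : realType) := MkUHP {
  UHP_pt :> R * R;
  UHP_gt0b : 0 < UHP_pt.2 }.

HB.instance Definition _ (R : realType) := [isSub for @UHP_pt R].
HB.instance Definition _ (R : realType) := [Choice of UHP R by <:].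
HB.instance Definition _ (R : realType) :=
  Topological.copy (UHP R) (initial_topology (@UHP_pt R)).

Section actions.
Variable R : realType.
Implicit Types (g h : PSL2 R) (M N : SL2 R) (z : UHP R).

(* |c z + d|^2 for z = x + i y *)
Definition moebius_den M z : R :=
  (M 1 0 * z.1 + M 1 1) ^+ 2 + (M 1 0 * z.2) ^+ 2.

Lemma det_SL2E M : M 0 0 * M 1 1 - M 0 1 * M 1 0 = 1.
Proof.
rewrite -(det_SL2 M) (expand_det_row _ 0) big_ord_recl big_ord1.
rewrite /cofactor !det_mx11 !mxE /= expr0 mul1r expr1 mulN1r mulrN.
by congr (_ * _ - _ * _); congr (SL2_mx M _ _); apply/val_inj.
Qed.

Lemma moebius_den_gt0 M z : 0 < moebius_den M z.
Proof.
have z2 := UHP_gt0b z; rewrite /moebius_den.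
have [c0|c0] := eqVneq (M 1 0) 0.
  have := det_SL2E M; rewrite c0 !mul0r mulr0 subr0 add0r expr0n addr0 => ad.
  by rewrite exprn_even_gt0//=; apply: contra_eqN ad => /eqP->;
    rewrite mulr0 eq_sym oner_eq0.
by rewrite ltr_wpDl ?sqr_ge0// exprn_even_gt0//= mulf_neq0// gt_eqF.
Qed.

(* The real and imaginary parts of (a z + b) / (c z + d); the numerator of
   the imaginary part is (a d - b c) y = y. *)
Definition moebius_pt M z : R * R :=
  (((M 0 0 * z.1 + M 0 1) * (M 1 0 * z.1 + M 1 1) + M 0 0 * M 1 0 * z.2 ^+ 2)
     / moebius_den M z,
   z.2 / moebius_den M z).

Fact moebius_pt_gt0 M z : 0 < (moebius_pt M z).2.
Proof. by rewrite divr_gt0 ?moebius_den_gt0// UHP_gt0b. Qed.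

Definition moebius M z : UHP R := MkUHP (moebius_pt_gt0 M z).

Definition PSL2_act g z : UHP R := moebius (repr g) z.

(* [option R] is the boundary R u {oo} of H, with None as oo. *)
Definition moebius_bd M (x : option R) : option R :=
  match x with
  | None => if M 1 0 == 0 then None else Some (M 0 0 / M 1 0)
  | Some t => if M 1 0 * t + M 1 1 == 0 then None
              else Some ((M 0 0 * t + M 0 1) / (M 1 0 * t + M 1 1))
  end.

Definition PSL2_bd g (x : option R) : option R := moebius_bd (repr g) x.

Lemma SL2_pmP M N : SL2_pm M N ->
  exists e : R, [/\ e != 0, e ^+ 2 = 1 & forall i j, M i j = e * N i j].
Proof.
move=> /orP[]/eqP ->; [exists 1|exists (-1)]; split=> [||i j];
  by rewrite ?oppr_eq0 ?oner_eq0 ?sqrrN ?expr1n ?mxE ?mul1r ?mulN1r.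
Qed.

Lemma PSL2_act_pi M z : PSL2_act (\pi_(PSL2 R) M) z = moebius M z.
Proof.
have [e [_ e1 E]] := SL2_pmP (repr_piP M).
apply/val_inj; rewrite /= /moebius_pt /moebius_den !E.
have e2 x y : (e * x) * (e * y) = x * y.
  by rewrite mulrACA -expr2 e1 mul1r.
have e3 x : (e * x) ^+ 2 = x ^+ 2 by rewrite exprMn e1 mul1r.
by rewrite -!mulrA -!mulrDr e2 !e3 !(mulrCA _ e) !mulrA -[e * e]expr2 e1 !mul1r.
Qed.

Lemma PSL2_bd_pi M x : PSL2_bd (\pi_(PSL2 R) M) x = moebius_bd M x.
Proof.
have [e [e0 _ E]] := SL2_pmP (repr_piP M).
have F u v : e * u / (e * v) = u / v by rewrite -mulf_div divff// mul1r.
have Z y : (e * y == 0) = (y == 0) by rewrite mulf_eq0 (negPf e0).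
rewrite /PSL2_bd /moebius_bd !E; case: x => [t|]; last by rewrite Z F.
by rewrite -!(mulrA e) -!mulrDr Z F.
Qed.

End actions.

Section lattices.
Variable R : realType.
Implicit Types (g : PSL2 R) (z : UHP R).
Variable G : set (PSL2 R).

Definition orbit_of z : set (UHP R) := [set PSL2_act g z | g in G].

(* The quotient G\H: its points are the G-orbits, seen as subsets of H. *)
Record orbit_space := MkOrbit {
  orbit_set : set (UHP R);
  orbit_setP : exists z, orbit_set = orbit_of z }.

Definition orbit_pi z : orbit_space := MkOrbit (ex_intro _ z erefl).
Definition orbit_repr (O : orbit_space) : UHP R := projT1 (cid (orbit_setP O)).

Fact orbit_reprK : cancel orbit_repr orbit_pi.
Proof.
case=> O OP; rewrite /orbit_pi /orbit_repr /=.
case: cid => z /= Oz; case: _ / (esym Oz) in OP *.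
by congr MkOrbit; exact: Prop_irrelevance.
Qed.

HB.instance Definition _ :=
  isQuotient.Build (UHP R) orbit_space orbit_reprK.

(* The area form is dx dy / y^2. *)
Definition hyperbolic_area (A : set (UHP R)) : \bar R :=
  (\int[lebesgue_measure \x lebesgue_measure]_(p in @UHP_pt R @` A)
     (p.2 ^- 2)%:E)%E.

(* The area of G\H is by definition the area of any such F. Translates overlap
   in null sets rather than being disjoint, so that closed Dirichlet domains
   and strict sets of orbit representatives both qualify. *)
Definition fundamental_domain (F : set (UHP R)) :=
  [/\ measurable (@UHP_pt R @` F : set (measurableTypeR R * measurableTypeR R)),
      forall z, exists2 g, G g & F (PSL2_act g z)
    & forall g, G g -> g != 1%g ->
        hyperbolic_area (F `&` PSL2_act g @` F) = 0%E].

Definition finite_coarea :=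
  exists2 F, fundamental_domain F & (hyperbolic_area F < +oo)%E.

Definition subgroup :=
  [/\ G 1%g, forall g h, G g -> G h -> G (g * h)%g
    & forall g, G g -> G g^-1%g].

Definition non_uniform_lattice :=
  [/\ subgroup, G `<=` isolated G, finite_coarea
    & ~ compact [set: quotient_topology orbit_space]].

(* This includes the identity, which is excluded in [cusp]. *)
Definition parabolic g := `|\tr (SL2_mx (repr g))| = 2.

Definition cusp (e : option R) :=
  exists g, [/\ G g, g != 1%g, parabolic g & PSL2_bd g e = e].

(* With a and c the first entries of the rows of a representing matrix; both
   a / c and c ^+ 2 are unchanged when the matrix is replaced by its opposite.
   An element with c = 0 maps oo to oo, hence approximates no real alpha. *)
Definition approximable (alpha k : R) :=
  exists S : set (PSL2 R),
    [/\ S `<=` G, infinite_set S, {in S &, injective (fun g => PSL2_bd g None)}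
      & forall g, S g -> let a := repr g 0 0 in let c := repr g 1 0 in
          c != 0 /\ `|alpha - a / c| < 1 / (k * c ^+ 2)].

(* The element 0 is added so that the supremum is taken in [0, +oo]. *)
Definition lagrange_constant (alpha : R) : \bar R :=
  ereal_sup (0%E |` [set k%:E | k in [set k : R | 0 < k /\ approximable alpha k]]).

Definition lagrange_spectrum_oo : set (\bar R) := range lagrange_constant.

End lattices.

(* The spectrum of G with respect to a cusp e, for a normalization g0 that maps
   e to oo. *)
Definition lagrange_spectrum (R : realType) (G : set (PSL2 R)) (g0 : PSL2 R) :
    set (\bar R) :=
  lagrange_spectrum_oo [set (g0 * g * g0^-1)%g | g in G].

(* Main.v *)
Require Import Defs.
From HB Require Import structures.
From mathcomp Require Import all_boot all_order all_algebra.
From mathcomp Require Import all_classical all_reals all_analysis.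
From mathcomp Require Import measurable_realfun ring lra.

(** Why there is a Hall ray.

    After conjugation the cusp is at infinity.  Let V be the set of first
    columns (a, c) of the matrices of the group: a vector of V stands for a
    cusp in the orbit of infinity, at the point [slope] = a / c, and infinity
    itself is (1, 0).  Everything is expressed by the determinant [wedge] of two
    vectors, which SL(2,R) preserves.  [pdist u p q] is the distance of the
    boundary points p and q measured after u has been moved to infinity, so
    that the geodesic from p to q climbs to the height [pdist u p q] (up to a
    factor 2) in the cusp u.  In these terms 1 / (c ^ 2 * |alpha - a / c|) is
    [pdist (a, c) (1, 0) (alpha, 1)], and L(alpha) is the upper limit of these
    heights.  A large l is realized by a geodesic ray which climbs infinitely
    often to heights tending to l and stays below a fixed bound in between.

    Discreteness makes cusps repel each other: the wedge of two vectors of V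
    is 0 or at least some c0 > 0 in absolute value ([lower_left_gap]).  Hence
    for every l there is an x such that both x and x - l stay away from all
    cusps, with a constant independent of l: in a nested choice of intervals,
    at each scale each of the two conditions spoils at most one of three
    candidates ([badly_approximable_pair]).  This plays the role of the
    theorem on sums of Cantor sets in Hall's proof for SL(2,Z).

    Finite area makes the orbit of infinity dense ([cusp_dense]).  Otherwise a
    box standing on a gap of the orbit would embed into the quotient, and a
    box reaching down to the boundary has infinite area; the comparison of
    areas ([packing_area]) rests on the invariance of dx dy / y ^ 2
    ([mobius_area]).  By density x and x - l may be replaced by nearby cusps p
    and q, chosen with least denominators, so that the vertical geodesics
    ending in p and q stay low in all other cusps: p and q are [linked] to
    infinity ([linked_cusp_near], [linked_pair]).

    Such pieces can be glued.  In a chain of cusps v_0 = infinity, v_1, ...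
    where consecutive ones are linked and where the gap at v_n, seen as
    [pdist v_n v_{n-1} v_{n+1}], is at least 1, the points v_n converge to some
    alpha; the height at v_n differs from the gap at v_n by a quantity that
    vanishes when the pieces get long ([value_near_gap]), and in all other
    cusps the height is bounded by a constant of the group
    ([other_values_bounded]).  With elements of the group one moves the pieces
    so that every other gap is close to a prescribed l_i; the parabolic
    translations at infinity keep the remaining gaps bounded ([chain_exists],
    [prescribed_values]).  Constant l_i give L(alpha) = l, and l_i tending to
    infinity give L(alpha) = +oo. *)

Set Implicit Arguments.
Unset Strict Implicit.
Unset Printing Implicit Defensive.
Import Order.TTheory GRing.Theory Num.Theory.
Import numFieldNormedType.Exports.

Local Open Scope classical_set_scope.
Local Open Scope ring_scope.
Local Open Scope quotient_scope.

(** * Matrices of determinant one *)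

Section SL2_entries.
Variable R : realType.
Implicit Types M N : SL2 R.

Lemma ord2P (i : 'I_2) : i = 0 \/ i = 1.
Proof. by case: i => [[|[|//]] ?]; [left|right]; exact/val_inj. Qed.

Lemma SL2_mulE M N i j : SL2_mul M N i j = M i 0 * N 0 j + M i 1 * N 1 j.
Proof.
rewrite /= mxE big_ord_recl big_ord1.
by congr (_ * _ + _ * _); congr (SL2_mx _ _ _); apply/val_inj.
Qed.

Lemma SL2_eqP M N : [/\ M 0 0 = N 0 0, M 0 1 = N 0 1, M 1 0 = N 1 0
  & M 1 1 = N 1 1] -> M = N.
Proof.
move=> [e1 e2 e3 e4]; apply/val_inj/matrixP => i j /=.
by case: (ord2P i) (ord2P j) => -> [] ->.
Qed.

Lemma SL2_of_det (a b c d : R) : a * d - b * c = 1 ->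
  \det (\matrix_(i < 2, j < 2)
    if i == 0 then if j == 0 then a else b else if j == 0 then c else d) == 1.
Proof.
move=> <-; apply/eqP; rewrite (expand_det_row _ 0) big_ord_recl big_ord1.
by rewrite /cofactor !det_mx11 !mxE /= expr0 mul1r expr1 mulN1r mulrN.
Qed.

Definition SL2_of (a b c d : R) (h : a * d - b * c = 1) : SL2 R :=
  MkSL2 (SL2_of_det h).

Lemma SL2_ofE (a b c d : R) (h : a * d - b * c = 1) :
  ((SL2_of h 0 0 = a) * (SL2_of h 0 1 = b) * (SL2_of h 1 0 = c) *
   (SL2_of h 1 1 = d))%type.
Proof. by rewrite /= !mxE. Qed.

Lemma SL2_invE M : ((SL2_inv M 0 0 = M 1 1) * (SL2_inv M 0 1 = - M 0 1) *
  (SL2_inv M 1 0 = - M 1 0) * (SL2_inv M 1 1 = M 0 0))%type.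
Proof.
have h : M 1 1 * M 0 0 - (- M 0 1) * (- M 1 0) = 1.
  by rewrite -[RHS](det_SL2E M); ring.
suff -> : SL2_inv M = SL2_of h by rewrite !SL2_ofE.
apply/val_inj => /=.
have K : SL2_mul M (SL2_of h) = SL2_one R.
  have D := det_SL2E M.
  apply: SL2_eqP; rewrite !SL2_mulE !SL2_ofE /SL2_one/= !mxE/=.
  by rewrite -D; split; ring.
have := congr1 (@SL2_mx R) K; rewrite /SL2_mul/= => /(congr1 ( *%R (SL2_mx M)^-1)).
by rewrite mulrA mulVr ?unit_SL2// mul1r mulr1 => ->.
Qed.

Lemma SL2_oneE : ((SL2_one R 0 0 = 1) * (SL2_one R 0 1 = 0) *
  (SL2_one R 1 0 = 0) * (SL2_one R 1 1 = 1))%type.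
Proof. by rewrite /= !mxE. Qed.

End SL2_entries.

(** * Discrete groups containing a translation *)

Section discrete.
Variable R : realType.

(** Discreteness at the identity, in coordinates; in a group it propagates to
    every element. *)
Definition isolated_one (Gam : set (SL2 R)) :=
  exists2 eps : R, 0 < eps & forall M, Gam M ->
  `|M 0 0 - 1| < eps -> `|M 0 1| < eps -> `|M 1 0| < eps ->
  `|M 1 1 - 1| < eps -> M = SL2_one R.

Variable Gam : set (SL2 R).
Hypothesis Gam1 : Gam (SL2_one R).
Hypothesis GamM : forall M N, Gam M -> Gam N -> Gam (SL2_mul M N).
Hypothesis GamV : forall M, Gam M -> Gam (SL2_inv M).
Hypothesis Gdisc : isolated_one Gam.

Definition unipotent (x : R) (M : SL2 R) :=
  [/\ M 0 0 = 1, M 0 1 = x, M 1 0 = 0 & M 1 1 = 1].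

Definition has_translation x := exists2 M, Gam M & unipotent x M.

Lemma has_translation0 : has_translation 0.
Proof. by exists (SL2_one R) => //; split; rewrite SL2_oneE. Qed.

Lemma has_translationD x y : has_translation x -> has_translation y ->
  has_translation (x + y).
Proof.
move=> [M GM [m1 m2 m3 m4]] [N GN [n1 n2 n3 n4]].
exists (SL2_mul M N); first exact: GamM.
by split; rewrite SL2_mulE ?m1 ?m2 ?m3 ?m4 ?n1 ?n2 ?n3 ?n4 ?m3 ?m4; ring.
Qed.

Lemma has_translationN x : has_translation x -> has_translation (- x).
Proof.
move=> [M GM [m1 m2 m3 m4]]; exists (SL2_inv M); first exact: GamV.
by split; rewrite SL2_invE ?m1 ?m2 ?m3 ?m4 ?oppr0.
Qed.

Lemma has_translationZ x (k : int) : has_translation x ->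
  has_translation (k%:~R * x).
Proof.
move=> hx; have hn n : has_translation (n%:R * x).
  elim: n => [|n ih]; first by rewrite mul0r; exact: has_translation0.
  by rewrite -addn1 natrD mulrDl mul1r; exact: has_translationD.
case: k => n; first exact: hn.
by rewrite NegzE mulrNz mulNr; apply: has_translationN; exact: hn.
Qed.

Lemma translation_gap : exists2 eps : R, 0 < eps &
  forall x, has_translation x -> `|x| < eps -> x = 0.
Proof.
have [eps e0 He] := Gdisc; exists eps => // x [M GM [m1 m2 m3 m4]] xe.
have := He M GM; rewrite m1 m2 m3 m4 subrr normr0 => /(_ e0 xe e0 e0) E.
by rewrite -m2 E SL2_oneE.
Qed.

Variable tau : R.
Hypothesis tau0 : tau != 0.
Hypothesis Gtau : has_translation tau.

(** A non-translation fixing infinity contracts, itself or by its inverse, the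
    translations of the group under conjugation, so their lengths would
    accumulate at 0. *)
Lemma stabilizer_square M : Gam M -> M 1 0 = 0 -> M 0 0 ^+ 2 = 1.
Proof.
have contr N : Gam N -> N 1 0 = 0 -> `|N 0 0| < 1 -> False.
  move=> GN c0 a1; have [eps e0 He] := translation_gap.
  have ad := det_SL2E N; rewrite c0 mulr0 subr0 in ad.
  have step x : has_translation x -> has_translation (N 0 0 ^+ 2 * x).
    move=> [X GX [x1 x2 x3 x4]].
    exists (SL2_mul (SL2_mul N X) (SL2_inv N)).
      by apply: GamM; [exact: GamM|exact: GamV].
    split; rewrite !SL2_mulE !SL2_invE ?x1 ?x2 ?x3 ?x4 ?c0; try ring; try (by ring: ad).
  have iter n : has_translation ((N 0 0 ^+ 2) ^+ n * tau).
    elim: n => [|n ih]; first by rewrite expr0 mul1r.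
    by rewrite exprS -mulrA; exact: step.
  have a0 : N 0 0 != 0.
    by apply: contra_eq_neq ad => ->; rewrite mul0r eq_sym oner_neq0.
  have cv : (fun n => (N 0 0 ^+ 2) ^+ n) @ \oo --> (0 : R).
    by apply: cvg_expr; rewrite normrX exprn_ilt1.
  have /cvgrPdist_lt/(_ (eps / `|tau|)) := cv.
  rewrite divr_gt0 ?normr_gt0// => /(_ isT)[n _ /(_ n (leqnn n))/=].
  rewrite sub0r normrN ltr_pdivlMr ?normr_gt0// -normrM => /(He _ (iter n))/eqP.
  by rewrite mulf_eq0 (negPf tau0) orbF !expf_eq0 (negPf a0) !andbF.
move=> GM c0; have ad := det_SL2E M; rewrite c0 mulr0 subr0 in ad.
have nad : `|M 0 0| * `|M 1 1| = 1 by rewrite -normrM ad normr1.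
have [lt1|gt1|eq1] := ltgtP `|M 0 0| 1.
- by case: (contr _ GM c0 lt1).
- case: (contr _ (GamV GM)); first by rewrite SL2_invE c0 oppr0.
  rewrite SL2_invE -(ltr_pM2l (lt_trans ltr01 gt1)) nad mulr1//.
- by rewrite -[LHS]ger0_norm ?sqr_ge0// normrX eq1 expr1n.
Qed.

(** If c is small, a left multiplication by a power of the translation T brings
    a within tau * c of 1; then the commutator of the new matrix with T is
    O(c)-close to 1, hence equal to 1, and its lower left entry
    - c ^ 2 * tau vanishes. *)
Lemma lower_left_gap : exists2 c0 : R, 0 < c0 &
  forall M, Gam M -> M 1 0 = 0 \/ c0 <= `|M 1 0|.
Proof.
have [eps e0 He] := Gdisc.
have t0 : 0 < `|tau| by rewrite normr_gt0.
pose m := 5 * `|tau| + 3 + `|tau|^-1.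
have m0 : 0 < m by rewrite /m !addr_gt0// ?mulr_gt0 ?invr_gt0.
pose b := Num.min 1 (eps / m).
have b0 : 0 < b by rewrite lt_min ltr01 divr_gt0.
exists (b / `|tau|); first exact: divr_gt0.
move=> M GM; have [->|c0] := eqVneq (M 1 0) 0; [by left|right].
rewrite leNgt; apply/negP => cb.
have {cb} eb : `|tau * M 1 0| < b.
  by rewrite normrM mulrC -ltr_pdivlMr.
set c := M 1 0 in c0 eb *; set h := `|tau * c| in eb.
have tc0 : tau * c != 0 by rewrite mulf_neq0.
have h0 : 0 < h by rewrite normr_gt0.
(* The power of the translation that brings the upper left entry near 1. *)
pose k := Num.floor ((1 - M 0 0) / (tau * c)).
have [X GX [x1 x2 x3 x4]] := has_translationZ k Gtau.
pose N := SL2_mul X M.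
have GN : Gam N by exact: GamM.
have Nc : N 1 0 = c by rewrite /N SL2_mulE x3 x4 mul0r add0r mul1r.
have N11 : N 1 1 = M 1 1 by rewrite /N SL2_mulE x3 x4 mul0r add0r mul1r.
have [y GY [y1 y2 y3 y4]] := Gtau.
pose d := N 0 0 - 1.
have dh : `|d| <= h.
  rewrite /d /N SL2_mulE x1 x2 mul1r -/c.
  set q := (1 - M 0 0) / (tau * c).
  have -> : M 0 0 + k%:~R * tau * c - 1 = (k%:~R - q) * (tau * c).
    by rewrite /q; field; rewrite c0 tau0.
  rewrite normrM -/h -[leRHS]mul1r ler_wpM2r// ?normr_ge0//.
  have := floor_itv q; rewrite -/k => /andP[k1 k2].
  by rewrite distrC ger0_norm ?subr_ge0// lerBlDl ltW// -intrD1.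
have N00 : N 0 0 = 1 + d by rewrite /d; ring.
clearbody d N.
pose P := SL2_mul (SL2_mul (SL2_mul N y) (SL2_inv N)) (SL2_inv y).
have GP : Gam P by do 3 (apply: GamM => //; try exact: GamV).
have detN : N 0 0 * N 1 1 = 1 + N 0 1 * c.
  by rewrite -(det_SL2E N) Nc; ring.
have P00 : P 0 0 - 1 = - (1 + d) * (tau * c).
  rewrite /P !SL2_mulE !SL2_invE y1 y2 y3 y4 Nc -N00.
  by ring: detN.
have P01 : P 0 1 = tau * (d * (2 + d) + (1 + d) * (tau * c)).
  rewrite /P !SL2_mulE !SL2_invE y1 y2 y3 y4 Nc.
  have -> : tau * (d * (2 + d) + (1 + d) * (tau * c)) =
    tau * (N 0 0 ^+ 2 - 1 + N 0 0 * (tau * c)) by rewrite N00; ring.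
  by ring: detN.
have P10 : P 1 0 = - (tau * c) ^+ 2 / tau.
  rewrite /P !SL2_mulE !SL2_invE y1 y2 y3 y4 Nc.
  by field.
have P11 : P 1 1 - 1 = (tau * c) ^+ 2 + (1 + d) * (tau * c).
  rewrite /P !SL2_mulE !SL2_invE y1 y2 y3 y4 Nc -N00.
  by ring: detN.
have [h1 hm] : h < 1 /\ h * m < eps.
  by move: eb; rewrite lt_min => /andP[-> ]; rewrite ltr_pdivlMr.
have d1 : `|1 + d| <= 2.
  by rewrite (le_trans (ler_normD _ _))// normr1; lra.
have d2 : `|2 + d| <= 3.
  by rewrite (le_trans (ler_normD _ _))// ger0_norm//; lra.
have htau : 0 < h * `|tau| by rewrite mulr_gt0.
have hti : 0 < h / `|tau| by rewrite divr_gt0.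
have hE : h * m = 5 * (h * `|tau|) + 3 * h + h / `|tau| by rewrite /m; ring.
have PE : P = SL2_one R.
  apply: He => //.
  - rewrite P00 normrM -/h normrN.
    have : `|1 + d| * h <= 2 * h by rewrite ler_wpM2r// ltW.
    by lra.
  - rewrite P01 normrM.
    have A : `|d * (2 + d) + (1 + d) * (tau * c)| <= 5 * h.
      rewrite (le_trans (ler_normD _ _))// (normrM d) (normrM (1 + d)) -/h.
      have : `|d| * `|2 + d| <= h * 3 by rewrite ler_pM.
      have : `|1 + d| * h <= 2 * h by rewrite ler_wpM2r// ltW.
      by lra.
    apply: (@le_lt_trans _ _ (`|tau| * (5 * h))); first by rewrite ler_wpM2l.
    apply: le_lt_trans hm; rewrite hE [X in _ <= X + _ + _](_ : _ = `|tau| * (5 * h)); last by ring.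
    by rewrite -addrA lerDl; lra.
  - rewrite P10 normrM normrN normfV normrX -/h.
    have : h ^+ 2 / `|tau| <= h / `|tau|.
      by rewrite ler_pM2r ?invr_gt0// expr2 ler_piMl// ltW.
    by lra.
  - rewrite P11 (le_lt_trans (ler_normD _ _))// normrX (normrM (1 + d)) -/h.
    have : `|1 + d| * h <= 2 * h by rewrite ler_wpM2r// ltW.
    have : h ^+ 2 <= h by rewrite expr2 ler_piMl// ltW.
    by lra.
have : P 1 0 = 0 by rewrite PE SL2_oneE.
by rewrite P10 => /eqP; rewrite mulf_eq0 oppr_eq0 expf_eq0/= (negPf tc0)
  invr_eq0 (negPf tau0).
Qed.

(** Two elements with entries bounded by B that lie in the same cell of a fine
    grid have a quotient near 1, hence agree; there are finitely many cells. *)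
Lemma bounded_finite (B : R) : finite_set [set M | Gam M /\ forall i j, `|M i j| <= B].
Proof.
have [eps e0 He] := Gdisc.
set A := [set M | _].
have [B0|B0] := ltP B 0.
  suff -> : A = set0 by exact: finite_set0.
  rewrite -subset0 => M [_ /(_ 0 0)]; rewrite leNgt => /negP; apply.
  by rewrite (lt_le_trans B0).
pose K := (2 * B + 1) / eps.
have K0 : 0 < K by rewrite /K divr_gt0// ltr_wpDl// mulr_ge0.
pose n := Num.truncn (2 * B * K).
pose g x := Num.truncn ((x + B) * K).
have gE x : `|x| <= B -> (g x <= n)%N.
  rewrite ler_norml => /andP[x1 x2]; apply: le_truncn; rewrite ler_pM2r//; lra.
have ginj x y : `|x| <= B -> `|y| <= B -> g x = g y -> `|x - y| < K^-1.
  rewrite !ler_norml => /andP[x1 x2] /andP[y1 y2] gxy.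
  have h (z : R) : - B <= z -> 0 <= (z + B) * K by move=> z1; rewrite mulr_ge0 ?(ltW K0)//; lra.
  have := truncn_itv (h _ x1); have := truncn_itv (h _ y1).
  rewrite -/(g x) -/(g y) gxy -natr1 => /andP[a1 a2] /andP[b1 b2].
  rewrite -[ltRHS]mul1r ltr_pdivlMr// -(gtr0_norm K0) -normrM ltr_norml.
  apply/andP; split; lra.
pose f (M : SL2 R) : 'I_n.+1 * 'I_n.+1 * 'I_n.+1 * 'I_n.+1 :=
  (inord (g (M 0 0)), inord (g (M 0 1)), inord (g (M 1 0)), inord (g (M 1 1))).
have finj : {in A &, injective f}.
  move=> M N; rewrite !inE => -[GM MB] [GN NB].
  have gi i j : inord (g (M i j)) = inord (g (N i j)) :> 'I_n.+1 ->
      `|M i j - N i j| < K^-1.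
    move=> /(congr1 val); rewrite /= !inordK ?ltnS ?gE// => E.
    exact: ginj.
  move=> [/gi h00 /gi h01 /gi h10 /gi h11].
  have E : SL2_mul (SL2_inv M) N = SL2_one R.
    have dM : M 0 0 * M 1 1 = 1 + M 0 1 * M 1 0 by rewrite -(det_SL2E M); ring.
    have KE : eps = (2 * B + 1) * K^-1.
      by rewrite /K invf_div mulrC mulfVK// gt_eqF// ltr_wpDl// mulr_ge0.
    have Ki : 0 < K^-1 by rewrite invr_gt0.
    have bd (a b x y : R) : `|a| <= B -> `|b| <= B -> `|x| < K^-1 -> `|y| < K^-1 ->
        `|a * x + b * y| < eps.
      move=> aB bB xK yK; rewrite (le_lt_trans (ler_normD _ _))// !normrM.
      have : `|a| * `|x| <= B * K^-1 by rewrite ler_pM// ltW.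
      have : `|b| * `|y| <= B * K^-1 by rewrite ler_pM// ltW.
      rewrite KE; lra.
    apply: He; first by apply: GamM => //; exact: GamV.
    - rewrite SL2_mulE !SL2_invE.
      have -> : M 1 1 * N 0 0 + - M 0 1 * N 1 0 - 1 =
        - M 1 1 * (M 0 0 - N 0 0) + M 0 1 * (M 1 0 - N 1 0) by ring: dM.
      by apply: bd; rewrite ?normrN.
    - rewrite SL2_mulE !SL2_invE.
      have -> : M 1 1 * N 0 1 + - M 0 1 * N 1 1 =
        - M 1 1 * (M 0 1 - N 0 1) + M 0 1 * (M 1 1 - N 1 1) by ring.
      by apply: bd; rewrite ?normrN.
    - rewrite SL2_mulE !SL2_invE.
      have -> : - M 1 0 * N 0 0 + M 0 0 * N 1 0 =
        M 1 0 * (M 0 0 - N 0 0) + - M 0 0 * (M 1 0 - N 1 0) by ring.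
      by apply: bd; rewrite ?normrN.
    - rewrite SL2_mulE !SL2_invE.
      have -> : - M 1 0 * N 0 1 + M 0 0 * N 1 1 - 1 =
        M 1 0 * (M 0 1 - N 0 1) + - M 0 0 * (M 1 1 - N 1 1) by ring: dM.
      by apply: bd; rewrite ?normrN.
  transitivity (SL2_mul M (SL2_mul (SL2_inv M) N)).
    by rewrite E; apply/val_inj; rewrite /= mulr1.
  by apply/val_inj; rewrite /= mulrA mulrV ?unit_SL2// mul1r.
rewrite -(eq_finite_set (inj_card_eq finj)); exact: finite_finset.
Qed.

Lemma discrete_enumerable : exists2 e : nat -> SL2 R, (forall k, Gam (e k)) &
  forall M, Gam M -> exists k, e k = M.
Proof.
have GE : Gam = \bigcup_n [set M | Gam M /\ forall i j, `|M i j| <= n%:R].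
  apply/seteqP; split=> M; last by case=> n _ [].
  move=> GM; exists (Num.truncn (\sum_i \sum_j `|M i j|)).+1 => //; split => // i j.
  apply: ltW; apply: le_lt_trans (truncnS_gt _).
  rewrite (bigD1 i)//= (bigD1 j)//= -addrA lerDl addr_ge0// sumr_ge0// => k _.
  by rewrite sumr_ge0.
have : countable Gam.
  rewrite GE; apply: bigcup_countable => // n _.
  by apply: finite_set_countable; exact: bounded_finite.
move=> /countable_injP[f finj].
(* A left inverse of an injection f of the group into the natural numbers;
   outside the range of f its value is any element of the group. *)
have ex n : exists M, Gam M /\ ((exists2 M, Gam M & f M = n) -> f M = n).
  have [[M GM fM]|no] := pselect (exists2 M, Gam M & f M = n); first by exists M.
  by exists (SL2_one R); split.
have [e eP] := choice ex.
exists e => [k|M GM]; first by case: (eP k).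
exists (f M); have [G1 /(_ (ex_intro2 _ _ M GM erefl)) E] := eP (f M).
by apply: finj; rewrite ?inE.
Qed.

End discrete.

(** * Cusps repel each other: badly approximable points and linked cusps *)

Section nested.
Variable R : realType.

(** Completeness, in the form used for both limit constructions below. *)
Lemma nested_balls (t r : nat -> R) :
  (forall n, `|t n.+1 - t n| + r n.+1 <= r n) -> (forall n, 0 <= r n) ->
  exists x, forall n, `|x - t n| <= r n.
Proof.
move=> H r0.
have lo n m : (n <= m)%N -> t n - r n <= t m - r m /\ t m + r m <= t n + r n.
  elim: m => [|m ih]; first by rewrite leqn0 => /eqP ->.
  rewrite leq_eqVlt => /predU1P[->//|]; rewrite ltnS => /ih[h1 h2].
  have := H m; have := ler_norm (t m.+1 - t m).
  have := ler_norm (- (t m.+1 - t m)); rewrite normrN; split; lra.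
have lh n m : t n - r n <= t m + r m.
  have [/lo[h1 h2]|/ltnW/lo[h1 h2]] := leqP n m.
    by have := r0 m; lra.
  by have := r0 n; lra.
pose S := [set t n - r n | n in [set: nat]].
have S0 : S !=set0 by exists (t 0 - r 0); exists 0%N.
have ub m : ubound S (t m + r m) by move=> _ [n _ <-]; exact: lh.
exists (sup S) => n.
have h1 : sup S <= t n + r n by apply: ge_sup => //; exact: ub.
have h2 : t n - r n <= sup S.
  by apply: ub_le_sup; [exists (t 0 + r 0)%R; exact: ub|exists n].
by rewrite ler_norml; apply/andP; split; lra.
Qed.

End nested.

Section cusps.
Variable R : realType.
Implicit Types p q u v w : R * R.

Definition wedge p q := p.1 * q.2 - p.2 * q.1.

Definition slope p := p.1 / p.2.

(** The identity a / c - a' / c' = (a c' - c a') / (c c'). *)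
Lemma slope_dist p q : p.2 != 0 -> q.2 != 0 ->
  `|slope p - slope q| * (`|p.2| * `|q.2|) = `|wedge p q|.
Proof.
move=> p0 q0; rewrite -!normrM /slope /wedge; congr `|_|.
by field; rewrite p0 q0.
Qed.

Variable V : set (R * R).
Variable c0 : R.
Hypothesis c00 : 0 < c0.
Hypothesis Vsep : forall u v, V u -> V v -> wedge u v = 0 \/ c0 <= `|wedge u v|.
Hypothesis Vinf : V (1, 0).

Lemma height_ge v : V v -> v.2 != 0 -> c0 <= `|v.2|.
Proof.
move=> Vv v0; have [] := Vsep Vinf Vv; rewrite /wedge/= mul1r mul0r subr0 //.
by move/eqP; rewrite (negPf v0).
Qed.

Lemma cusp_separation u v : V u -> V v -> u.2 != 0 -> v.2 != 0 ->
  slope u != slope v -> c0 <= `|slope u - slope v| * (`|u.2| * `|v.2|).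
Proof.
move=> Vu Vv u0 v0 uv; rewrite slope_dist//; case: (Vsep Vu Vv) => // w0.
have := slope_dist u0 v0; rewrite w0 normr0 => /eqP.
by rewrite !mulf_eq0 !normr_eq0 (negPf u0) (negPf v0) !orbF subr_eq0 (negPf uv).
Qed.

Definition badly_approximable (k x : R) := forall v, V v -> v.2 != 0 ->
  k <= v.2 ^+ 2 * `|x - slope v|.

Definition in_band (n : nat) v :=
  [/\ V v, v.2 != 0, c0 ^+ 2 * 6 ^+ n <= v.2 ^+ 2 & v.2 ^+ 2 < c0 ^+ 2 * 6 ^+ n.+1].

(** The nested construction treats at step n the cusps of the n-th band, whose
    squared denominators lie between two consecutive terms of the progression
    c0 ^ 2 * 6 ^ n. *)
Lemma band_exists v : V v -> v.2 != 0 -> exists n, in_band n v.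
Proof.
move=> Vv v0; have c2 : 0 < c0 ^+ 2 by rewrite exprn_gt0.
have lb : c0 ^+ 2 <= v.2 ^+ 2.
  by rewrite -(real_normK (num_real v.2)) ler_pXn2r ?nnegrE ?(ltW c00)// height_ge.
pose P n := v.2 ^+ 2 < c0 ^+ 2 * 6 ^+ n.+1.
have exP : exists n, P n.
  exists (Num.truncn (v.2 ^+ 2 / c0 ^+ 2)).
  rewrite /P mulrC -ltr_pdivrMr//; apply: lt_le_trans (truncnS_gt _) _.
  set m := Num.truncn _ ; rewrite -natrX ler_nat.
  by apply: ltnW; rewrite ltn_expl.
case: (ex_minnP exP) => n Pn nmin; exists n; split => //.
case: n Pn nmin => [_ _|n Pn nmin]; first by rewrite expr0 mulr1.
by rewrite leNgt; apply/negP => /nmin; rewrite ltnn.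
Qed.

(** The constant 1 / 12 makes a ball of step n so small that two cusps of the
    n-th band are a full diameter apart ([band_separation]); the ratio 6 leaves
    room for three disjoint candidates and their safety margin. *)
Definition ball_radius (n : nat) : R := (12 * c0)^-1 / 6 ^+ n.

Lemma ball_radius_gt0 n : 0 < ball_radius n.
Proof. by rewrite /ball_radius divr_gt0 ?invr_gt0 ?mulr_gt0// exprn_gt0. Qed.

Lemma ball_radiusS n : ball_radius n.+1 = ball_radius n / 6.
Proof.
rewrite /ball_radius exprS; field.
by rewrite expf_neq0//= gt_eqF.
Qed.

Lemma band_separation n u v : in_band n u -> in_band n v -> slope u != slope v ->
  2 * ball_radius n <= `|slope u - slope v|.
Proof.
move=> [Vu u0 _ uu] [Vv v0 _ vv] uv.
have := cusp_separation Vu Vv u0 v0 uv.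
have uv0 : 0 < `|u.2| * `|v.2| by rewrite mulr_gt0// normr_gt0.
rewrite -ler_pdivrMr//; apply: le_trans; rewrite ler_pdivlMr//.
pose L := c0 ^+ 2 * 6 ^+ n.+1.
have le : `|u.2| * `|v.2| <= L.
  have L0 : 0 < L by rewrite mulr_gt0// exprn_gt0.
  rewrite -(@ler_pXn2r _ 2)// ?nnegrE ?(ltW uv0) ?(ltW L0)//.
  rewrite exprMn !real_normK ?num_real// [leRHS]expr2.
  by rewrite ler_pM ?sqr_ge0// ltW.
have cE : c0 = 2 * ball_radius n * L.
  rewrite /ball_radius /L (exprS _ n); field.
  by rewrite expf_neq0//= gt_eqF.
rewrite [leRHS]cE.
by rewrite ler_pM2l// mulr_gt0// ball_radius_gt0.
Qed.

Definition hits n (l t : R) :=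
  exists2 v, in_band n v & `|slope v + l - t| < ball_radius n / 3.

(** Two candidates spoiled by cusps of the same family, shifted by l, are too
    close to be spoiled by distinct cusps and too far apart to be spoiled by
    the same one. *)
Lemma hits_unique n l t t' : 2 / 3 * ball_radius n <= `|t - t'| ->
  `|t - t'| <= 4 / 3 * ball_radius n -> hits n l t -> hits n l t' -> False.
Proof.
move=> tt1 tt2 [u bu hu] [v bv hv].
have h1 := ler_distD (slope u + l) t t'.
have h2 := ler_distD (slope v + l) (slope u + l) t'.
have h3 := ler_distD t (slope u + l) (slope v + l).
have h4 := ler_distD t' t (slope v + l).
have e : slope u + l - (slope v + l) = slope u - slope v by ring.
rewrite e in h2 h3.
rewrite [`|t - (slope u + l)|]distrC in h1; rewrite [`|t' - (slope v + l)|]distrC in h4.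
have [euv|nuv] := eqVneq (slope u) (slope v).
  have : `|slope u - slope v| = 0 by rewrite euv subrr normr0.
  by lra.
have := band_separation bu bv nuv.
lra.
Qed.

(** There are three candidates and two families of cusps, namely all cusps and
    their translates by l; each family spoils at most one candidate. *)
Lemma dodge_step n (l t : R) : exists t', `|t' - t| + ball_radius n.+1 <= ball_radius n /\
  forall x v, `|x - t'| <= ball_radius n.+1 -> in_band n v ->
    c0 / 72 <= v.2 ^+ 2 * `|x - slope v| /\
    c0 / 72 <= v.2 ^+ 2 * `|x - l - slope v|.
Proof.
have r0 := ball_radius_gt0 n; set r := ball_radius n in r0.
have rS := ball_radiusS n; rewrite -/r in rS.
have d12 : `|t - 2 / 3 * r - t| = 2 / 3 * r.
  by rewrite addrC addKr normrN gtr0_norm// mulr_gt0.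
have d23 : `|t - (t + 2 / 3 * r)| = 2 / 3 * r.
  by rewrite opprD addrA subrr add0r normrN gtr0_norm// mulr_gt0.
have d13 : `|t - 2 / 3 * r - (t + 2 / 3 * r)| = 4 / 3 * r.
  have -> : t - 2 / 3 * r - (t + 2 / 3 * r) = - (4 / 3 * r) by ring.
  by rewrite normrN gtr0_norm// mulr_gt0.
have [t' [tt' nh0 nhl]] : exists t', [/\ `|t' - t| <= 2 / 3 * r, ~ hits n 0 t'
    & ~ hits n l t'].
  apply: contrapT => no.
  have H t' : `|t' - t| <= 2 / 3 * r -> hits n 0 t' \/ hits n l t'.
    move=> h; have [|h0] := pselect (hits n 0 t'); first by left.
    by have [|hl] := pselect (hits n l t'); [right|case: no; exists t'].
  have U12 m := @hits_unique n m (t - 2 / 3 * r) t.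
  have U23 m := @hits_unique n m t (t + 2 / 3 * r).
  have U13 m := @hits_unique n m (t - 2 / 3 * r) (t + 2 / 3 * r).
  have {}U12 m : hits n m (t - 2 / 3 * r) -> hits n m t -> False.
    by apply: U12; rewrite d12 -/r; lra.
  have {}U23 m : hits n m t -> hits n m (t + 2 / 3 * r) -> False.
    by apply: U23; rewrite d23 -/r; lra.
  have {}U13 m : hits n m (t - 2 / 3 * r) -> hits n m (t + 2 / 3 * r) -> False.
    by apply: U13; rewrite d13 -/r; lra.
  have [] := H (t - 2 / 3 * r); first by rewrite d12.
    have [] := H t; first by rewrite subrr normr0; lra.
      by move=> h h'; exact: (U12 0).
    have [] := H (t + 2 / 3 * r); first by rewrite distrC d23.
      by move=> h1 h2 h3; exact: (U13 0).
    by move=> h1 h2 _; exact: (U23 l).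
  have [] := H t; first by rewrite subrr normr0; lra.
    have [] := H (t + 2 / 3 * r); first by rewrite distrC d23.
      by move=> h1 h2 _; exact: (U23 0).
    by move=> h1 _ h2; exact: (U13 l).
  by move=> h h'; exact: (U12 l).
exists t'; split; first by rewrite -/r rS; lra.
have main x v m : `|x - t'| <= ball_radius n.+1 -> in_band n v -> ~ hits n m t' ->
    c0 / 72 <= v.2 ^+ 2 * `|x - m - slope v|.
  rewrite rS => xt bv nh.
  have far : r / 3 <= `|slope v + m - t'|.
    by rewrite leNgt; apply/negP => lt; apply: nh; exists v.
  have near : r / 6 <= `|x - m - slope v|.
    have := ler_distD x (slope v + m) t'.
    have -> : slope v + m - x = - (x - m - slope v) by ring.
    rewrite normrN; lra.
  have [_ _ lo _] := bv.
  have -> : c0 / 72 = c0 ^+ 2 * 6 ^+ n * (r / 6).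
    by rewrite /r /ball_radius; field; rewrite expf_neq0//= gt_eqF.
  apply: ler_pM => //; first by rewrite mulr_ge0 ?sqr_ge0// exprn_ge0.
  by rewrite ltW// divr_gt0.
move=> x v xt bv; split; last exact: main.
by have := main x v 0 xt bv nh0; rewrite subr0.
Qed.

(** The substitute for Hall's theorem: every l is a difference of two points
    of the set of badly approximable points with one fixed constant. *)
Lemma badly_approximable_pair l :
  exists2 x, badly_approximable (c0 / 72) x & badly_approximable (c0 / 72) (x - l).
Proof.
have [f fP] := choice (fun nt : nat * R => dodge_step nt.1 l nt.2).
pose t := fix t n := if n is m.+1 then f (m, t m) else 0.
have [x xt] : exists x, forall n, `|x - t n| <= ball_radius n.
  apply: nested_balls => n; last by rewrite ltW// ball_radius_gt0.
  by have [] := fP (n, t n).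
exists x => v Vv v0; have [n bn] := band_exists Vv v0;
  by have [_ /(_ x v (xt n.+1) bn)[]] := fP (n, t n).
Qed.

(** The vertical geodesic between v and w stays below a fixed height in every
    other cusp u: in matrix coordinates where v is infinity, this says that the
    distance of u and w is at least k divided by the square of the denominator
    of u.  The condition is symmetric in v and w. *)
Definition linked (k : R) v w := forall u, V u -> wedge u v != 0 ->
  wedge u w != 0 -> k * `|wedge v w| <= `|wedge u v| * `|wedge u w|.

Hypothesis Vdense : forall s r : R, 0 < r ->
  exists v, [/\ V v, v.2 != 0 & `|slope v - s| < r].

(** Halving the squared denominator repeatedly must stop, since denominators
    are bounded below; the cusp where it stops is minimal up to the factor 2
    among those with good approximation to s. *)
Lemma minimal_near (k s r : R) : 0 < k -> (exists v, [/\ V v, v.2 != 0 & slope v = s]) ->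
  exists v, [/\ V v, v.2 != 0, v.2 ^+ 2 * `|slope v - s| <= k &
    forall u, V u -> u.2 != 0 -> u.2 ^+ 2 < v.2 ^+ 2 / 2 -> k < u.2 ^+ 2 * `|slope u - s|].
Proof.
move=> k0 [v [Vv v0 vs]]; apply: contrapT => no.
pose A v := [/\ V v, v.2 != 0 & v.2 ^+ 2 * `|slope v - s| <= k].
have step w : A w -> exists2 u, A u & u.2 ^+ 2 < w.2 ^+ 2 / 2.
  move=> [Vw w0 wk]; apply: contrapT => nou; apply: no; exists w; split => // u Vu u0 uw.
  by rewrite ltNge; apply/negP => uk; apply: nou; exists u.
have desc n : exists2 u, A u & u.2 ^+ 2 <= v.2 ^+ 2 / 2 ^+ n.
  elim: n => [|n [w Aw wn]].
    exists v; last by rewrite expr0 divr1.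
    by split => //; rewrite vs subrr normr0 mulr0 ltW.
  have [u Au uw] := step w Aw; exists u => //.
  apply: (le_trans (ltW uw)); rewrite (exprSr _ n) invfM mulrA.
  by rewrite ler_pM2r// invr_gt0.
pose n := Num.truncn (v.2 ^+ 2 / c0 ^+ 2).
have c2 : 0 < c0 ^+ 2 by rewrite exprn_gt0.
have [u [Vu u0 _] un] := desc n.+1.
have lb : c0 ^+ 2 <= u.2 ^+ 2.
  by rewrite -(real_normK (num_real u.2)) ler_pXn2r ?nnegrE ?(ltW c00)// height_ge.
have := le_trans lb un; rewrite ler_pdivlMr ?exprn_gt0// mulrC -ler_pdivlMr//.
apply/negP; rewrite -ltNge; apply: lt_le_trans (truncnS_gt _) _.
by rewrite -natrX ler_nat ltnW// ltn_expl.
Qed.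

(** Let s be a cusp extremely close to x, and v a cusp with v.2 ^ 2 * |v - s|
    <= c0 / 144 of nearly least denominator.  A cusp of smaller denominator
    fails that inequality, hence is far from v; a cusp of comparable or larger
    denominator is far from v because cusps repel.  Since x is badly
    approximable, v has a large denominator, and hence is close to x. *)
Lemma linked_cusp_near x (eps W : R) : 0 < eps -> badly_approximable (c0 / 72) x ->
  exists v, [/\ V v, v.2 != 0, linked (c0 / 288) (1, 0) v,
    `|slope v - x| < eps & W <= `|v.2|].
Proof.
move=> e0 badx; pose k := c0 / 144.
have k0 : 0 < k by rewrite divr_gt0.
have W2 : 0 < W ^+ 2 + 1 by rewrite ltr_wpDl// sqr_ge0.
pose d := Num.min (eps / 4) (k / (W ^+ 2 + 1)).
have d0 : 0 < d by rewrite lt_min !divr_gt0.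
have d1 : d <= eps / 4 by rewrite ge_min lexx.
have d2 : d <= k / (W ^+ 2 + 1) by rewrite ge_min lexx orbT.
have [s [Vs s0 sx]] := Vdense x d0.
have [v [Vv v0 vk vmin]] : exists v, [/\ V v, v.2 != 0, v.2 ^+ 2 * `|slope v - slope s| <= k &
    forall u, V u -> u.2 != 0 -> u.2 ^+ 2 < v.2 ^+ 2 / 2 -> k < u.2 ^+ 2 * `|slope u - slope s|].
  by apply: (@minimal_near k (slope s) 0 k0); exists s.
have v2 : 0 < v.2 ^+ 2 by rewrite exprn_even_gt0.
have near : `|slope v - slope s| <= k / v.2 ^+ 2 by rewrite ler_pdivlMr// mulrC.
have kd : k / v.2 ^+ 2 <= d.
  have := badx v Vv v0.
  rewrite [leRHS]mulrC -ler_pdivrMr// distrC => h.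
  have := ler_distD (slope s) (slope v) x.
  have : c0 / 72 / v.2 ^+ 2 = 2 * (k / v.2 ^+ 2) by rewrite /k; field.
  lra.
exists v; split => //.
- move=> u Vu; rewrite /wedge/= => u0 uv0.
  have {}u0 : u.2 != 0.
    by move: u0; rewrite mulr0 mulr1 sub0r oppr_eq0.
  rewrite mul1r mul0r subr0 mulr0 mulr1 sub0r normrN -/(wedge u v).
  have u2 : 0 < u.2 ^+ 2 by rewrite exprn_even_gt0.
  have nu : 0 < `|u.2| by rewrite normr_gt0.
  have nv : 0 < `|v.2| by rewrite normr_gt0.
  have wc : c0 <= `|wedge u v|.
    by case: (Vsep Vu Vv) => // w0; move: uv0; rewrite -/(wedge u v) w0 eqxx.
  have [small|big] := ltP (u.2 ^+ 2) (v.2 ^+ 2 / 2).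
    have far := vmin u Vu u0 small.
    have : k / u.2 ^+ 2 < `|slope u - slope s| by rewrite ltr_pdivrMr// mulrC.
    have h1 : k / v.2 ^+ 2 <= (k / u.2 ^+ 2) / 2.
      rewrite ler_pdivrMr// [leRHS](_ : _ = k * (v.2 ^+ 2 / 2 / u.2 ^+ 2)).
        2: by field; rewrite ?u0 ?v0.
      by rewrite ler_peMr ?(ltW k0)// ler_pdivlMr// mul1r ltW.
    have h2 := ler_distD (slope v) (slope u) (slope s).
    move=> h3.
    have : k / u.2 ^+ 2 / 2 <= `|slope u - slope v| by lra.
    rewrite -(slope_dist u0 v0) => h4.
    have -> : c0 / 288 * `|v.2| = k / u.2 ^+ 2 / 2 * (`|u.2| ^+ 2 * `|v.2|).
      by rewrite real_normK ?num_real// /k; field; rewrite ?u0 ?v0.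
    rewrite [leRHS](_ : _ = `|slope u - slope v| * (`|u.2| ^+ 2 * `|v.2|)); last by ring.
    by rewrite ler_pM2r// mulr_gt0// exprn_gt0.
  have : `|v.2| <= 2 * `|u.2|.
    rewrite -(@ler_pXn2r _ 2)// ?nnegrE ?mulr_ge0//.
    by rewrite exprMn !real_normK ?num_real//; lra.
  have : `|u.2| * c0 <= `|u.2| * `|wedge u v| by rewrite ler_wpM2l.
  move=> h1 h2.
  have : c0 / 288 * `|v.2| <= c0 / 288 * (2 * `|u.2|).
    have k288 : 0 <= c0 / 288 := divr_ge0 (ltW c00) (ler0n R 288).
    exact: (ler_wpM2l k288 h2).
  have : 0 < `|u.2| * c0 by rewrite mulr_gt0.
  lra.
- have := ler_distD (slope s) (slope v) x; lra.
- have : (W ^+ 2 + 1) <= v.2 ^+ 2.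
    have := le_trans kd d2.
    by rewrite ler_pdivrMr// mulrAC -ler_pdivrMr ?invr_gt0// invrK ler_pM2l.
  have [W0|W0] := leP W 0; first by move=> _; rewrite (le_trans W0).
  move=> h; rewrite -(@ler_pXn2r _ 2)// ?nnegrE ?(ltW W0)//.
  by rewrite real_normK ?num_real//; lra.
Qed.

Lemma linked_pair (l eps W : R) : 0 < eps -> exists p q,
  [/\ V p /\ V q, p.2 != 0 /\ q.2 != 0,
    linked (c0 / 288) (1, 0) p /\ linked (c0 / 288) (1, 0) q,
    `|slope p - slope q - l| < eps & W <= `|p.2| /\ W <= `|q.2|].
Proof.
move=> e0; have [x b1 b2] := badly_approximable_pair l.
have e20 : 0 < eps / 2 by rewrite divr_gt0.
have [p [Vp p0 lp px pW]] := linked_cusp_near W e20 b1.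
have [q [Vq q0 lq qx qW]] := linked_cusp_near W e20 b2.
exists p, q; split => //.
have -> : slope p - slope q - l = (slope p - x) - (slope q - (x - l)) by ring.
have := ler_normB (slope p - x) (slope q - (x - l)); lra.
Qed.

End cusps.

(** * Distances seen from a cusp *)

Section pdist.
Variable R : realType.
Implicit Types p q u v w : R * R.

(** The distance of p and q in the affine chart of the projective line in
    which v is the point at infinity. *)
Definition pdist v p q := `|wedge p q| / (`|wedge p v| * `|wedge q v|).

Lemma wedgeC p q : wedge p q = - wedge q p.
Proof. by rewrite /wedge; ring. Qed.

Lemma wedge_eq0C p q : (wedge p q == 0) = (wedge q p == 0).
Proof. by rewrite wedgeC oppr_eq0. Qed.

Lemma norm_wedgeC p q : `|wedge p q| = `|wedge q p|.
Proof. by rewrite wedgeC normrN. Qed.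

Lemma pdistC v p q : pdist v p q = pdist v q p.
Proof. by rewrite /pdist norm_wedgeC [_ * `|wedge q v|]mulrC. Qed.

(** This is the three-term (Pluecker) relation between the wedges of p, q, r
    and v. *)
Lemma pdist_triangle v p q r : wedge p v != 0 -> wedge q v != 0 -> wedge r v != 0 ->
  pdist v p r <= pdist v p q + pdist v q r.
Proof.
move=> p0 q0 r0.
have E s t : wedge s v != 0 -> wedge t v != 0 ->
    pdist v s t = `|wedge s t / (wedge s v * wedge t v)|.
  by move=> s0 t0; rewrite normrM normfV normrM.
rewrite !E//; apply: le_trans (ler_normD _ _).
suff -> : wedge p r / (wedge p v * wedge r v) =
  wedge p q / (wedge p v * wedge q v) + wedge q r / (wedge q v * wedge r v) by [].
have pl : wedge p r * wedge q v = wedge p q * wedge r v + wedge q r * wedge p v.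
  by rewrite /wedge; ring.
have -> : wedge p r = (wedge p q * wedge r v + wedge q r * wedge p v) / wedge q v.
  by rewrite -pl mulfK.
by field; rewrite p0 q0 r0.
Qed.

(** Passing from the chart at v to the chart at w is an inversion. *)
Lemma pdist_flip v w p : wedge v w != 0 -> wedge p v != 0 -> wedge p w != 0 ->
  pdist v p w * pdist w p v = (`|wedge v w| ^+ 2)^-1.
Proof.
move=> vw pv pw; rewrite /pdist [`|wedge w v|]norm_wedgeC.
by field; rewrite !normr_eq0 vw pv pw.
Qed.

Lemma pdist_flip_le v w p (k : R) : wedge v w != 0 -> wedge p v != 0 -> wedge p w != 0 ->
  0 < k -> k <= pdist v p w -> pdist w p v <= (k * `|wedge v w| ^+ 2)^-1.
Proof.
move=> vw pv pw k0 kd; have := pdist_flip vw pv pw.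
have d0 : 0 < pdist v p w by exact: lt_le_trans kd.
move=> /(congr1 ( *%R (pdist v p w)^-1)); rewrite mulKf ?gt_eqF// => ->.
by rewrite [leRHS]invfM ler_wpM2r ?invr_ge0 ?exprn_ge0// lef_pV2.
Qed.

Lemma pdist_self v p : pdist v p p = 0.
Proof. by rewrite /pdist /wedge [p.2 * _]mulrC subrr normr0 mul0r. Qed.

(** If w is a distant neighbour of v and p is close to w as seen from v, then u
    is about as far from p as from w.  The distance of u and w is bounded below
    by the linking condition, which suffices when the wedge of u and v is
    small, and by the comparison of the wedges of u with v and w, which
    suffices when it is large. *)
Lemma separated_from_neighbour (k W : R) v w p u : 0 < k -> 32 <= W ->
  `|wedge v w| = W -> wedge u v != 0 -> wedge u w != 0 -> wedge p v != 0 ->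
  k * W <= `|wedge u v| * `|wedge u w| ->
  `|wedge u v| <= 2 * `|wedge u w| -> pdist v p w <= 8 / W ^+ 2 ->
  k / 2 <= `|wedge u v| ^+ 2 * pdist v p u.
Proof.
move=> k0 W32 vw uv uw pv kW D2 pw.
have W0 : 0 < W by lra.
have wv : wedge w v != 0 by rewrite -normr_gt0 norm_wedgeC vw.
have tri := pdist_triangle uv pv wv.
have uE : pdist v u w = `|wedge u w| / (`|wedge u v| * W).
  by rewrite /pdist [`|wedge w v|]norm_wedgeC vw.
set D := `|wedge u v| in kW D2 uE *; set D' := `|wedge u w| in kW D2 uE *.
have D0 : 0 < D by rewrite normr_gt0.
have DW : 0 < D * W by rewrite mulr_gt0.
have D20 : 0 < D ^+ 2 by rewrite exprn_gt0.
have W20 : 0 < W ^+ 2 by rewrite exprn_gt0.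
rewrite [pdist v u p]pdistC in tri.
have lo : pdist v u w - 8 / W ^+ 2 <= pdist v p u by lra.
rewrite [leRHS]mulrC -ler_pdivrMr//; apply: le_trans lo; rewrite uE.
have h1 : k / D ^+ 2 <= D' / (D * W).
  rewrite ler_pdivrMr// [leRHS](_ : _ = D' * D / W); last by field; rewrite gt_eqF// gt_eqF.
  by rewrite ler_pdivlMr// [D' * D]mulrC.
have h2 : (2 * W)^-1 <= D' / (D * W).
  rewrite ler_pdivlMr// [leLHS](_ : _ = D / 2); last by field; rewrite gt_eqF.
  lra.
(* For small D the term 8 / W ^ 2 is at most half of the bound k / D ^ 2. *)
have [small|big] := leP (16 * D ^+ 2) (k * W ^+ 2).
  have : 8 / W ^+ 2 <= k / 2 / D ^+ 2.
    by rewrite ler_pdivrMr// mulrAC ler_pdivlMr//; lra.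
  have : k / D ^+ 2 = k / 2 / D ^+ 2 + k / 2 / D ^+ 2 by field; rewrite gt_eqF.
  lra.
have h3 : k / 2 / D ^+ 2 <= 8 / W ^+ 2.
  by rewrite ler_pdivrMr// mulrAC ler_pdivlMr//; lra.
have h4 : 16 / W ^+ 2 <= (2 * W)^-1.
  rewrite ler_pdivrMr// [leRHS](_ : _ = W / 2); last by field; rewrite gt_eqF.
  lra.
have : 16 / W ^+ 2 = 8 / W ^+ 2 + 8 / W ^+ 2 by field; rewrite gt_eqF.
lra.
Qed.

End pdist.

(** * The end point of a chain of linked cusps *)

Section limit.
Variable R : realType.
Implicit Types p q u w : R * R.
Variable V : set (R * R).
Variables c0 k : R.
Hypothesis c00 : 0 < c0.
Hypothesis k0 : 0 < k.
Hypothesis Vsep : forall u v, V u -> V v -> wedge u v = 0 \/ c0 <= `|wedge u v|.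
Variable v : nat -> R * R.
Hypothesis v0 : v 0%N = (1, 0).
Hypothesis vV : forall n, V (v n).
Local Notation W n := (`|wedge (v n) (v n.+1)|).
Hypothesis W32 : forall n, 32 <= W n.
Hypothesis vlinked : forall n, linked V k (v n) (v n.+1).
Hypothesis vgap : forall n, 1 <= pdist (v n.+1) (v n) (v n.+2).

Let W0 n : 0 < W n. Proof. have := W32 n; lra. Qed.
Let Wn0 n : wedge (v n) (v n.+1) != 0.
Proof. by rewrite -normr_gt0. Qed.
Let Wn0' n : wedge (v n.+1) (v n) != 0.
Proof. by rewrite wedge_eq0C. Qed.
Let WX n : 32 * 32 <= W n ^+ 2.
Proof. by rewrite expr2 ler_pM. Qed.
Let WX0 n : 0 < W n ^+ 2.
Proof. have := WX n; lra. Qed.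

Lemma wedge_infty p : wedge (1, 0) p = p.2.
Proof. by rewrite /wedge/= mul1r mul0r subr0. Qed.

(** Seen from a cusp of the chain, the starting point (1, 0) is close to the
    previous cusp; the gap then keeps it away from the next one. *)
Lemma start_bounds n : [/\ (v n.+1).2 != 0,
  pdist (v n.+1) (1, 0) (v n) <= 2 / W n ^+ 2 &
  2^-1 <= pdist (v n.+1) (1, 0) (v n.+2)].
Proof.
elim: n => [|n [h2 near far]].
  have c1 : (v 1).2 != 0 by rewrite -wedge_infty -v0.
  split => //; first by rewrite -v0 pdist_self divr_ge0// ltW.
  by rewrite -v0; have := vgap 0; lra.
have far0 : 0 < pdist (v n.+1) (1, 0) (v n.+2) by lra.
have c2 : (v n.+2).2 != 0.
  rewrite -wedge_infty; apply: contraTneq far0 => e.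
  by rewrite /pdist e normr0 mul0r ltxx.
have e1 : wedge (1, 0) (v n.+1) != 0 by rewrite wedge_infty.
have e2 : wedge (1, 0) (v n.+2) != 0 by rewrite wedge_infty.
have near' : pdist (v n.+2) (1, 0) (v n.+1) <= 2 / W n.+1 ^+ 2.
  have h : 0 < 2^-1 :> R by rewrite invr_gt0.
  have := pdist_flip_le (Wn0 n.+1) e1 e2 h far.
  by rewrite invfM invrK.
split => //.
have := pdist_triangle (Wn0 n.+1) e2 (Wn0' n.+2).
have := vgap n.+1.
rewrite [pdist _ (v n.+1) (1, 0)]pdistC.
have : 2 / W n.+1 ^+ 2 <= 2^-1.
  by rewrite ler_pdivrMr//; have := WX n.+1; lra.
lra.
Qed.

Lemma heightS n : `|(v n.+2).2| =
  `|(v n.+1).2| * W n.+1 * pdist (v n.+1) (1, 0) (v n.+2).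
Proof.
have [h1 _ _] := start_bounds n.
rewrite /pdist !wedge_infty [`|wedge (v n.+2) _|]norm_wedgeC.
by field; rewrite !normr_eq0 h1 Wn0.
Qed.

(** In particular the cusps of the chain are pairwise distinct. *)
Lemma height_double n : 2 * `|(v n.+1).2| <= `|(v n.+2).2|.
Proof.
have [h1 _ h2] := start_bounds n; rewrite heightS mulrC -mulrA ler_wpM2l//.
have : W n.+1 * 2^-1 <= W n.+1 * pdist (v n.+1) (1, 0) (v n.+2) by rewrite ler_wpM2l.
have := W32 n.+1; lra.
Qed.

Lemma slope_step n : `|slope (v n.+2) - slope (v n.+1)| =
  (`|(v n.+1).2| ^+ 2 * pdist (v n.+1) (1, 0) (v n.+2))^-1.
Proof.
have [h1 _ h2] := start_bounds n; have [h1' _ _] := start_bounds n.+1.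
have d0 : 0 < pdist (v n.+1) (1, 0) (v n.+2) by lra.
have := slope_dist h1' h1; rewrite norm_wedgeC heightS => e.
have hn : `|(v n.+1).2| != 0 by rewrite normr_eq0.
have hw : W n.+1 != 0 by rewrite normr_eq0.
move: d0 e; set d := pdist _ _ _ => /lt0r_neq0 d0 e.
clearbody d.
have -> : `|slope (v n.+2) - slope (v n.+1)| =
    W n.+1 / (`|(v n.+1).2| * W n.+1 * d * `|(v n.+1).2|).
  apply: (canRL (mulfK _)); last exact: e.
  by rewrite !mulf_neq0.
by field; rewrite hn d0 hw.
Qed.

Lemma limit_slope : exists x, forall n, `|x - slope (v n.+1)| <= 4 / `|(v n.+1).2| ^+ 2.
Proof.
apply: (@nested_balls _ (fun n => slope (v n.+1)) (fun n => 4 / `|(v n.+1).2| ^+ 2)); last first.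
  by move=> n; rewrite divr_ge0// exprn_ge0.
move=> n; rewrite slope_step.
have [h1 _ h2] := start_bounds n; have [h1' _ _] := start_bounds n.+1.
have d0 : 0 < pdist (v n.+1) (1, 0) (v n.+2) by lra.
set d := pdist _ _ _ in h2 d0 *; set c := `|(v n.+1).2|.
have c1 : 0 < c by rewrite normr_gt0.
have c2 : 0 < c ^+ 2 by rewrite exprn_gt0.
have l1 : (c ^+ 2 * d)^-1 <= 2 / c ^+ 2.
  rewrite invfM [leRHS]mulrC ler_wpM2l ?invr_ge0 ?(ltW c2)//.
  by rewrite -[leRHS]invrK lef_pV2 ?posrE ?invr_gt0.
have l2 : 4 / `|(v n.+2).2| ^+ 2 <= 1 / c ^+ 2.
  have hd := height_double n; rewrite -/c in hd.
  have c'0 : 0 < `|(v n.+2).2| ^+ 2 by rewrite exprn_gt0// normr_gt0.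
  rewrite ler_pdivrMr// mulrAC ler_pdivlMr// mul1r.
  have -> : 4 * c ^+ 2 = (2 * c) ^+ 2 by ring.
  by rewrite ler_pXn2r// ?nnegrE// mulr_ge0// ltW.
have e4 : 4 / c ^+ 2 = 2 / c ^+ 2 + 1 / c ^+ 2 + 1 / c ^+ 2 by field; rewrite gt_eqF.
have : 0 < 1 / c ^+ 2 by rewrite divr_gt0.
lra.
Qed.

Section limit_point.
Variable alpha : R.
Hypothesis alpha_lim : forall n, `|alpha - slope (v n.+1)| <= 4 / `|(v n.+1).2| ^+ 2.

Lemma wedge_limit p : p.2 != 0 -> `|wedge (alpha, 1) p| = `|p.2| * `|alpha - slope p|.
Proof.
move=> p0; rewrite -normrM /slope /wedge/=; congr `|_|.
by field.
Qed.

(** The counterpart of [start_bounds] for the end point: seen from a cusp of the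
    chain, it is close to the next cusp. *)
Lemma end_bounds n : wedge (alpha, 1) (v n) != 0 /\
  pdist (v n) (alpha, 1) (v n.+1) <= 8 / W n ^+ 2.
Proof.
case: n => [|n].
  have [h1 _ _] := start_bounds 0; have := alpha_lim 0.
  rewrite v0 /pdist (norm_wedgeC (v 1)) wedge_infty (wedge_limit h1) wedgeC wedge_infty/= oppr_eq0.
  rewrite normrN normr1 mul1r => a1; split; first exact: oner_neq0.
  have c1 : 0 < `|(v 1).2| by rewrite normr_gt0.
  rewrite mulrAC mulfV ?gt_eqF// mul1r (le_trans a1)//.
  by rewrite ler_wpM2r ?invr_ge0 ?exprn_ge0//; lra.
have [h1 _ far] := start_bounds n; have [h2 _ _] := start_bounds n.+1.
have step := slope_step n; have hS := heightS n; have a2 := alpha_lim n.+1.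
move: far step hS; set d := pdist _ _ _ => far step hS; clearbody d.
have w := W32 n.+1.
set c := `|(v n.+1).2| in step hS; set c' := `|(v n.+2).2| in a2 hS.
have c1 : 0 < c by rewrite normr_gt0.
have c2 : 0 < c' by rewrite normr_gt0.
have d0 : 0 < d by lra.
have wd : 0 < W n.+1 by exact: W0.
have a3 : 4 / c' ^+ 2 <= (c ^+ 2 * d)^-1 / 2.
  have -> : 4 / c' ^+ 2 = (c ^+ 2 * d)^-1 * (4 / (W n.+1 ^+ 2 * d)).
    by rewrite hS; field; rewrite !gt_eqF.
  rewrite ler_wpM2l ?invr_ge0 ?mulr_ge0 ?exprn_ge0 ?(ltW c1) ?(ltW d0)//.
  rewrite ler_pdivrMr ?mulr_gt0//.
  have : W n.+1 ^+ 2 * 2^-1 <= W n.+1 ^+ 2 * d by rewrite ler_wpM2l// ltW.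
  have := WX n.+1; lra.
have dist1 : (c ^+ 2 * d)^-1 / 2 <= `|alpha - slope (v n.+1)|.
  have := ler_distD alpha (slope (v n.+2)) (slope (v n.+1)); rewrite step.
  rewrite [`|slope _ - alpha|]distrC.
  lra.
have cd0 : 0 < (c ^+ 2 * d)^-1 by rewrite invr_gt0 mulr_gt0// exprn_gt0.
have ax0 : 0 < `|alpha - slope (v n.+1)| by lra.
have wn0 : wedge (alpha, 1) (v n.+1) != 0.
  by rewrite -normr_gt0 wedge_limit// mulr_gt0.
split => //.
rewrite /pdist wedge_limit// wedge_limit// -/c -/c' (norm_wedgeC (v n.+2)).
rewrite ler_pdivrMr ?mulr_gt0//.
apply: (@le_trans _ _ (c' * (4 / c' ^+ 2))); first by rewrite ler_pM2l.
apply: (@le_trans _ _ (8 / W n.+1 ^+ 2 * (c * ((c ^+ 2 * d)^-1 / 2) * W n.+1))).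
  rewrite hS le_eqVlt; apply/orP; left; apply/eqP.
  by field; rewrite !gt_eqF.
rewrite ler_wpM2l ?divr_ge0 ?(ltW (WX0 _))//.
by rewrite ler_wpM2r ?(ltW wd)// ler_wpM2l// ltW.
Qed.

(** Seen from a cusp of the chain, the two end points of the ray are close to
    the two neighbouring cusps. *)
Lemma value_near_gap n :
  `|pdist (v n.+1) (1, 0) (alpha, 1) - pdist (v n.+1) (v n) (v n.+2)| <=
    2 / W n ^+ 2 + 8 / W n.+1 ^+ 2.
Proof.
have [h1 near _] := start_bounds n; have [w1 fin] := end_bounds n.+1.
have e1 : wedge (1, 0) (v n.+1) != 0 by rewrite wedge_infty.
have t1 := pdist_triangle e1 (Wn0 n) w1.
have t2 := pdist_triangle (Wn0 n) (Wn0' n.+1) w1.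
have t3 := pdist_triangle (Wn0 n) e1 (Wn0' n.+1).
have t4 := pdist_triangle e1 w1 (Wn0' n.+1).
rewrite [pdist _ (v n.+2) (alpha, 1)]pdistC in t2.
rewrite [pdist _ (v n) (1, 0)]pdistC in t3.
by rewrite ler_norml; apply/andP; split; lra.
Qed.

(** Choose n such that the wedge of u and v_n is at most twice the wedges of u
    with v_{n-1} and with v_{n+1}.  Seen from v_n, both end points of the ray
    are close to the neighbours of v_n, and u is separated from these. *)
Lemma other_values_bounded u : V u -> u.2 != 0 -> (forall n, wedge u (v n) != 0) ->
  wedge (alpha, 1) u != 0 /\ pdist u (1, 0) (alpha, 1) <= 4 / k.
Proof.
move=> Vu u0 un.
pose D n := `|wedge u (v n)|.
have D0 n : 0 < D n by rewrite normr_gt0.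
have Dc n : c0 <= D n.
  by case: (Vsep Vu (vV n)) => // e; have := un n; rewrite e eqxx.
(* D cannot halve forever; take the first n where it does not. *)
have [n Dn Dmin] : exists2 n, D n <= 2 * D n.+1 & forall m, n = m.+1 -> D n <= 2 * D m.
  have ex : exists n, D n <= 2 * D n.+1.
    apply: contrapT => no.
    have dec n : D n * 2 ^+ n <= D 0%N.
      elim: n => [|n ih]; first by rewrite expr0 mulr1.
      apply: le_trans ih; rewrite (exprS _ n) mulrA ler_wpM2r ?exprn_ge0//.
      by rewrite mulrC leNgt; apply/negP => h; apply: no; exists n; rewrite ltW.
    pose n := Num.truncn (D 0%N / c0).
    have := dec n.+1; rewrite leNgt => /negP; apply.
    have : D 0%N / c0 < 2 ^+ n.+1.
      apply: lt_le_trans (truncnS_gt _) _.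
      by rewrite -natrX ler_nat ltnW// ltn_expl.
    rewrite ltr_pdivrMr// mulrC => /lt_le_trans; apply.
    by rewrite ler_wpM2r// exprn_ge0.
  case: (ex_minnP ex) => n Dn nmin; exists n => // m nm.
  have : ~~ (D m <= 2 * D m.+1) by apply/negP => /nmin; rewrite nm ltnn.
  by rewrite -nm -ltNge; have := D0 m; lra.
have [wn end_n] := end_bounds n.
have lk := vlinked Vu (un n) (un n.+1).
have fwd := separated_from_neighbour k0 (W32 n) (erefl _) (un n) (un n.+1)
  wn lk Dn end_n.
have D20 : 0 < D n ^+ 2 by rewrite exprn_gt0.
have k20 : 0 < k / 2 by rewrite divr_gt0.
have pos : 0 < pdist (v n) (alpha, 1) u.
  by rewrite -(pmulr_rgt0 _ D20); exact: lt_le_trans fwd.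
have au : wedge (alpha, 1) u != 0.
  apply: contraTneq pos => e.
  by rewrite /pdist e normr0 mul0r ltxx.
split => //.
have vu m : wedge (v m) u != 0 by rewrite wedge_eq0C.
have flip p : wedge p (v n) != 0 -> wedge p u != 0 ->
    k / 2 <= D n ^+ 2 * pdist (v n) p u -> pdist u p (v n) <= 2 / k.
  move=> pv pu h.
  have h' : k / 2 / D n ^+ 2 <= pdist (v n) p u by rewrite ler_pdivrMr// [leRHS]mulrC.
  have := @pdist_flip_le _ (v n) u p _ (vu n) pv pu _ h'.
  rewrite divr_gt0// => /(_ isT); rewrite norm_wedgeC -/(D n) mulfVK ?gt_eqF//.
  by rewrite invf_div.
have e1u : wedge (1, 0) u != 0 by rewrite wedge_infty.
have f1 := flip _ wn au fwd.
have k10 : 0 < 2 / k by rewrite divr_gt0.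
have k4 : 4 / k = 2 / k + 2 / k by field; rewrite gt_eqF.
case: n => [|n] in Dn Dmin wn end_n lk fwd D20 pos flip f1 *.
  by rewrite -v0 pdistC; lra.
have lk' := vlinked Vu (un n) (un n.+1).
rewrite [leRHS]mulrC in lk'.
have [h1 near _] := start_bounds n.
have e1n : wedge (1, 0) (v n.+1) != 0 by rewrite wedge_infty.
have near' : pdist (v n.+1) (1, 0) (v n) <= 8 / W n ^+ 2.
  by apply: le_trans near _; rewrite ler_wpM2r ?invr_ge0 ?(ltW (WX0 _))//; lra.
have bwd := separated_from_neighbour k0 (W32 n) (norm_wedgeC _ _) (un n.+1)
  (un n) e1n lk' (Dmin n erefl) near'.
have f2 := flip _ e1n e1u bwd.
have := pdist_triangle e1u (vu n.+1) au.
rewrite [pdist u (v n.+1) (alpha, 1)]pdistC; lra.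
Qed.

End limit_point.

End limit.

(** * Chains of cusps with prescribed heights *)

Section sequences.
Variable R : realType.
Implicit Types (M N : SL2 R) (p q u v : R * R).

Definition act M p : R * R :=
  (M 0 0 * p.1 + M 0 1 * p.2, M 1 0 * p.1 + M 1 1 * p.2).

Lemma act_mul M N p : act (SL2_mul M N) p = act M (act N p).
Proof. by rewrite /act !SL2_mulE /=; congr (_, _); ring. Qed.

Lemma actK M p : act (SL2_inv M) (act M p) = p.
Proof.
have D : M 0 0 * M 1 1 = 1 + M 0 1 * M 1 0 by rewrite -(det_SL2E M); ring.
by case: p => x y; rewrite /act !SL2_invE /=; congr (_, _); ring: D.
Qed.

Lemma actKV M p : act M (act (SL2_inv M) p) = p.
Proof.
have D : M 0 0 * M 1 1 = 1 + M 0 1 * M 1 0 by rewrite -(det_SL2E M); ring.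
by case: p => x y; rewrite /act !SL2_invE /=; congr (_, _); ring: D.
Qed.

Lemma act_infty M : act M (1, 0) = (M 0 0, M 1 0).
Proof. by rewrite /act /= !mulr1 !mulr0 !addr0. Qed.

Lemma wedge_act M p q : wedge (act M p) (act M q) = wedge p q.
Proof.
have D : M 0 0 * M 1 1 = 1 + M 0 1 * M 1 0 by rewrite -(det_SL2E M); ring.
by rewrite /wedge /act /=; ring: D.
Qed.

Lemma pdist_act M v p q : pdist (act M v) (act M p) (act M q) = pdist v p q.
Proof. by rewrite /pdist !wedge_act. Qed.

Lemma pdist_infty p q : p.2 != 0 -> q.2 != 0 ->
  pdist (1, 0) p q = `|slope p - slope q|.
Proof.
move=> p0 q0; rewrite /pdist !(norm_wedgeC _ (1, 0)) !wedge_infty -slope_dist//.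
by rewrite mulfK// mulf_neq0 ?normr_eq0.
Qed.

Variable Gam : set (SL2 R).
Hypothesis Gam1 : Gam (SL2_one R).
Hypothesis GamM : forall M N, Gam M -> Gam N -> Gam (SL2_mul M N).
Hypothesis GamV : forall M, Gam M -> Gam (SL2_inv M).
Variable c0 : R.
Hypothesis c00 : 0 < c0.
Hypothesis Ggap : forall M, Gam M -> M 1 0 = 0 \/ c0 <= `|M 1 0|.
Variable tau : R.
Hypothesis tau0 : tau != 0.
Hypothesis Gtau : has_translation Gam tau.
Hypothesis Gdense : forall s r : R, 0 < r ->
  exists M, [/\ Gam M, M 1 0 != 0 & `|M 0 0 / M 1 0 - s| < r].

(** The orbit of infinity, in homogeneous coordinates. *)
Definition cusp_vectors : set (R * R) := [set act M (1, 0) | M in Gam].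
Local Notation V := cusp_vectors.

Lemma cusp_vectors_act M p : Gam M -> V p -> V (act M p).
Proof.
by move=> GM [N GN <-]; exists (SL2_mul M N); [exact: GamM|rewrite act_mul].
Qed.

Lemma cusp_vectors_infty : V (1, 0).
Proof. by exists (SL2_one R) => //; rewrite act_infty !SL2_oneE. Qed.

Lemma cusp_vectors_gap u v : V u -> V v -> wedge u v = 0 \/ c0 <= `|wedge u v|.
Proof.
move=> [M GM <-] [N GN <-].
have -> : wedge (act M (1, 0)) (act N (1, 0)) = (SL2_mul (SL2_inv M) N) 1 0.
  rewrite -(wedge_act (SL2_inv M)) actK -act_mul act_infty wedge_infty//.
by apply: Ggap; apply: GamM => //; exact: GamV.
Qed.

Lemma cusp_vectors_dense (s r : R) : 0 < r ->
  exists v, [/\ V v, v.2 != 0 & `|slope v - s| < r].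
Proof.
move=> /(Gdense s)[M [GM c r1]]; exists (act M (1, 0)); split.
- by exists M.
- by rewrite act_infty.
- by rewrite act_infty.
Qed.

Lemma linked_act k M p q : Gam M -> linked V k p q -> linked V k (act M p) (act M q).
Proof.
move=> GM pq u Vu; have uE : u = act M (act (SL2_inv M) u) by rewrite actKV.
rewrite uE !wedge_act; apply: pq.
by apply: cusp_vectors_act => //; exact: GamV.
Qed.

Lemma linked_sym k p q : linked V k p q -> linked V k q p.
Proof.
move=> pq u Vu uq up; rewrite norm_wedgeC mulrC [leRHS]mulrC mulrC.
exact: pq.
Qed.

Lemma unipotent_infty x X : unipotent x X -> act X (1, 0) = (1, 0).
Proof. by move=> [x1 x2 x3 x4]; rewrite act_infty x1 x3. Qed.

Lemma unipotent_slope x X p : unipotent x X -> p.2 != 0 ->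
  (act X p).2 = p.2 /\ slope (act X p) = slope p + x.
Proof.
move=> [x1 x2 x3 x4] p0; rewrite /slope /act /= x1 x2 x3 x4 !mul1r mul0r add0r.
by split=> //; field.
Qed.

(** Translating by multiples of tau brings any gap into a fixed bounded range
    above 1. *)
Lemma translate_into (y z : R) : exists X x, [/\ Gam X, unipotent x X &
  1 <= z + x - y <= 1 + `|tau|].
Proof.
have t0 : 0 < `|tau| by rewrite normr_gt0.
have Gabs : has_translation Gam `|tau|.
  by case: (ger0P tau) => // _; exact: has_translationN.
pose k := Num.ceil ((1 + y - z) / `|tau|).
have [X GX uX] := has_translationZ Gam1 GamM GamV k Gabs.
exists X, (k%:~R * `|tau|); split => //.
have := ceil_itv ((1 + y - z) / `|tau|); rewrite -/k => /andP[k1 k2].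
rewrite ltr_pdivlMr// intrB mulrBl mul1r in k1.
rewrite ler_pdivrMr// in k2.
by apply/andP; split; lra.
Qed.

Section targets.
Variable l : nat -> R.
Hypothesis l2 : forall i, 2 <= l i.

Let k := c0 / 288.

(** The chain is the orbit of infinity under the partial products of the word
    P_0 Q_0 P_1 Q_1 ...  The gap at a cusp of the chain depends only on the
    two adjacent letters.  The cusps Q_i oo and P_i^-1 oo are taken from
    [linked_pair], which makes their difference close to l_i; P_i may still be
    multiplied on the left by a translation, which adjusts the gap between
    Q_{i-1} and P_i without changing P_i^-1 oo. *)
Lemma chain_exists : exists P Q : nat -> SL2 R,
  [/\ forall i, Gam (P i) /\ Gam (Q i),
      forall i, linked V k (1, 0) (act (P i) (1, 0)) /\ linked V k (1, 0) (act (Q i) (1, 0)),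
      forall i, 32 * i.+1%:R <= `|(act (P i) (1, 0)).2| /\ 32 * i.+1%:R <= `|(act (Q i) (1, 0)).2|,
      forall i, `|pdist (1, 0) (act (SL2_inv (P i)) (1, 0)) (act (Q i) (1, 0)) - l i|
         < (2 * i.+1%:R)^-1 &
      forall i, 1 <= pdist (1, 0) (act (SL2_inv (Q i)) (1, 0)) (act (P i.+1) (1, 0))
        <= 1 + `|tau|].
Proof.
have step i : exists NM : SL2 R * SL2 R, [/\ Gam NM.1 /\ Gam NM.2,
    (act NM.1 (1, 0)).2 != 0 /\ (act NM.2 (1, 0)).2 != 0,
    linked V k (1, 0) (act NM.1 (1, 0)) /\ linked V k (1, 0) (act NM.2 (1, 0)),
    `|slope (act NM.2 (1, 0)) - slope (act NM.1 (1, 0)) - l i| < (2 * i.+1%:R)^-1 &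
    32 * i.+1%:R <= `|(act NM.1 (1, 0)).2| /\ 32 * i.+1%:R <= `|(act NM.2 (1, 0)).2|].
  have e0 : 0 < (2 * i.+1%:R)^-1 :> R by rewrite invr_gt0 mulr_gt0.
  have [_ [_ [[[M GM <-] [N GN <-]] [p0 q0] [lp lq] d [Wp Wq]]]] :=
    linked_pair c00 cusp_vectors_gap cusp_vectors_infty cusp_vectors_dense
      (l i) (32 * i.+1%:R) e0.
  by exists (N, M).
have {step}[NM NMP] := choice step.
pose N i := (NM i).1; pose Q i := (NM i).2.
have invne M : (act M (1, 0)).2 != 0 -> (act (SL2_inv M) (1, 0)).2 != 0.
  by rewrite !act_infty /= SL2_invE oppr_eq0.
have stepX i : exists X, exists x, [/\ Gam X, unipotent x X &
    1 <= slope (act (SL2_inv (N i)) (1, 0)) + x -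
      (if i is j.+1 then slope (act (SL2_inv (Q j)) (1, 0)) else 0) <= 1 + `|tau|].
  exact: translate_into.
have [X XP] := choice stepX.
pose P i := SL2_mul (X i) (SL2_inv (N i)).
have actP i : act (P i) (1, 0) = act (X i) (act (SL2_inv (N i)) (1, 0)).
  by rewrite /P act_mul.
have GX i : Gam (X i) by have [x []] := XP i.
have GN i : Gam (N i) by have [[]] := NMP i.
have GQ i : Gam (Q i) by have [[]] := NMP i.
have GP i : Gam (P i) by apply: GamM => //; exact: GamV.
have P2 i : `|(act (P i) (1, 0)).2| = `|(act (N i) (1, 0)).2|.
  have [_ [n0 _] _ _ _] := NMP i; have [x [_ ux _]] := XP i.
  rewrite actP; have [-> _] := unipotent_slope ux (invne _ n0).
  by rewrite !act_infty /= SL2_invE normrN.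
have iP i : act (SL2_inv (P i)) (1, 0) = act (N i) (1, 0).
  have [x [_ ux _]] := XP i.
  have h : act (P i) (act (N i) (1, 0)) = (1, 0).
    by rewrite /P act_mul actK (unipotent_infty ux).
  by rewrite -{1}h actK.
exists P, Q; split => //.
- move=> i; have [_ _ [ln lq] _ _] := NMP i; split; last exact: lq.
  have := linked_act (GP i) (linked_sym ln).
  by rewrite -iP actKV.
- move=> i; have [_ _ _ _ [wn wq]] := NMP i; split; last exact: wq.
  by rewrite P2.
- move=> i; have [_ [n0 q0] _ d _] := NMP i.
  rewrite iP pdist_infty//.
  have pos : 0 <= slope (act (Q i) (1, 0)) - slope (act (N i) (1, 0)).
    have e1 : (2 * i.+1%:R)^-1 <= 1 :> R.
      rewrite invf_le1 ?mulr_gt0//.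
      have : 1 <= i.+1%:R :> R by rewrite ler1n.
      by lra.
    have := l2 i; move: d e1; rewrite /Q /N; set e := (_ * _)^-1; clearbody e.
    by rewrite ltr_norml => /andP[d1 d2]; lra.
  by rewrite (distrC (slope (act (N i) _))) (ger0_norm pos).
- move=> i; have [x [_ ux b]] := XP i.+1.
  have [_ [n0 _] _ _ _] := NMP i.+1; have [_ [_ q0] _ _ _] := NMP i.
  have [h2 hs] := unipotent_slope ux (invne _ n0).
  rewrite actP pdist_infty ?h2 ?invne// hs distrC ger0_norm//.
  by case/andP: b => b _; lra.
Qed.

Hypothesis Gstab : forall M, Gam M -> M 1 0 = 0 -> M 0 0 ^+ 2 = 1.

(** The stabilizer of infinity consists of translations, up to sign, so the
    denominator of a cusp is well defined up to sign. *)
Lemma parallel_cusp_vectors u v : V u -> V v -> wedge u v = 0 ->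
  u = v \/ u = (- v.1, - v.2).
Proof.
move=> [M GM <-] [N GN <-] w0.
pose L := SL2_mul (SL2_inv N) M.
have GL : Gam L by apply: GamM => //; exact: GamV.
have L0 : L 1 0 = 0.
  rewrite -[LHS]/((L 0 0, L 1 0).2) -act_infty -wedge_infty /L act_mul.
  by rewrite -(wedge_act N) actKV wedgeC w0 oppr0.
have e : act M (1, 0) = act N (act L (1, 0)) by rewrite /L act_mul actKV.
have /eqP := Gstab GL L0; rewrite sqrf_eq1 => /orP[]/eqP L00.
  by left; rewrite e (act_infty L) L00 L0.
right; rewrite e (act_infty L) L00 L0 /act /=; congr (_, _); ring.
Qed.

(** The cusps v i are those of odd index 2 i + 1 in the chain, where the gap is
    close to l i; the cusps of even index have bounded heights. *)
Lemma prescribed_values : exists (alpha : R) (v : nat -> R * R),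
  [/\ forall i, V (v i) /\ (v i).2 != 0,
      forall i j, slope (v i) = slope (v j) -> i = j,
      forall i, `|pdist (v i) (1, 0) (alpha, 1) - l i| < i.+1%:R^-1 &
      forall u, V u -> u.2 != 0 -> (exists i, wedge u (v i) = 0) \/
        wedge (alpha, 1) u != 0 /\
        pdist u (1, 0) (alpha, 1) <= 4 / k + (2 + `|tau|)].
Proof.
have [P [Q [GPQ lPQ hPQ gap1 gap2]]] := chain_exists.
(* The letters of the word P_0 Q_0 P_1 Q_1 ... and its partial products. *)
pose w n := if odd n then Q n./2 else P n./2.
have Gw n : Gam (w n) by rewrite /w; case: ifP => _; case: (GPQ n./2).
pose g := fix g n := if n is m.+1 then SL2_mul (g m) (w m) else SL2_one R.
have Gg n : Gam (g n) by elim: n => //= n ih; exact: GamM.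
pose v n := act (g n) (1, 0).
have vS n : v n.+1 = act (g n) (act (w n) (1, 0)) by rewrite /v /= act_mul.
have vSV n : v n = act (g n.+1) (act (SL2_inv (w n)) (1, 0)).
  by rewrite /v /= act_mul actKV.
have vV n : V (v n) by exists (g n).
have v0 : v 0%N = (1, 0) by rewrite /v /= act_infty !SL2_oneE.
have WE n : `|wedge (v n) (v n.+1)| = `|(act (w n) (1, 0)).2|.
  by rewrite vS {1}/v wedge_act wedge_infty.
have wh n : 32 * (n./2).+1%:R <= `|wedge (v n) (v n.+1)|.
  by rewrite WE /w; case: ifP => _; case: (hPQ n./2).
have W32 n : 32 <= `|wedge (v n) (v n.+1)|.
  by apply: le_trans (wh n); rewrite ler_peMr// ler1n.
have lnk n : linked V k (v n) (v n.+1).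
  rewrite vS; apply: linked_act => //.
  by rewrite /w; case: ifP => _; case: (lPQ n./2).
have gE n : pdist (v n.+1) (v n) (v n.+2) =
    pdist (1, 0) (act (SL2_inv (w n)) (1, 0)) (act (w n.+1) (1, 0)).
  by rewrite (vSV n) (vS n.+1) {1}/v pdist_act.
have gapE i : pdist (v (i.*2).+1) (v i.*2) (v (i.*2).+2) =
    pdist (1, 0) (act (SL2_inv (P i)) (1, 0)) (act (Q i) (1, 0)).
  by rewrite gE /w /= odd_double /= uphalf_double doubleK.
have gapO i : pdist (v (i.*2).+2) (v (i.*2).+1) (v (i.*2).+3) =
    pdist (1, 0) (act (SL2_inv (Q i)) (1, 0)) (act (P i.+1) (1, 0)).
  by rewrite gE /w /= odd_double /= uphalf_double doubleK.
have e1 i : (2 * i.+1%:R)^-1 <= 2^-1 :> R.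
  by rewrite lef_pV2 ?posrE// ?mulr_gt0// ler_peMr// ler1n.
have parity n : exists i, n = i.*2 \/ n = (i.*2).+1.
  exists n./2; have h := odd_double_half n.
  by case: (odd n) h => /= h; [right|left]; rewrite -{1}h.
have gap n : 1 <= pdist (v n.+1) (v n) (v n.+2).
  have [i [->|->]] := parity n; last by rewrite gapO; case/andP: (gap2 i).
  rewrite gapE; have := gap1 i; have := e1 i; set e := (_ * _)^-1; clearbody e.
  by rewrite ltr_norml => h /andP[a _]; have := l2 i; lra.
have k0 : 0 < k by rewrite /k divr_gt0 ?c00 ?ltr0n.
have [alpha alim] := limit_slope v0 W32 gap.
have vn0 n : (v n.+1).2 != 0 by have [] := start_bounds v0 W32 gap n.
have val := value_near_gap v0 W32 gap alim.
have err i n : (i <= n./2)%N ->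
    2 / `|wedge (v n) (v n.+1)| ^+ 2 + 8 / `|wedge (v n.+1) (v n.+2)| ^+ 2
      <= (2 * i.+1%:R)^-1.
  move=> iN; pose m : R := i.+1%:R.
  have m1 : 1 <= m by rewrite ler1n.
  have Wm j : (n./2 <= j./2)%N -> (`|wedge (v j) (v j.+1)| ^+ 2)^-1 <= (32 * m)^-1.
    move=> nj; have Wj : 32 * m <= `|wedge (v j) (v j.+1)|.
      apply: le_trans (wh j); rewrite ler_pM2l// ler_nat ltnS.
      exact: leq_trans nj.
    have mm : 32 * m <= `|wedge (v j) (v j.+1)| ^+ 2.
      apply: (@le_trans _ _ ((32 * m) * (32 * m))); last by rewrite expr2 ler_pM//; lra.
      have : 32 * m * 1 <= 32 * m * (32 * m) by rewrite ler_pM2l; lra.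
      lra.
    have p1 : 0 < 32 * m by lra.
    by rewrite lef_pV2 ?posrE// (lt_le_trans p1 mm).
  have h1 := Wm n (leqnn _); have h2 := Wm n.+1 (half_leq (leqnSn n)).
  rewrite -/m; clearbody m; have m0 : m != 0 by apply: lt0r_neq0; lra.
  have -> : (2 * m)^-1 = 16 * (32 * m)^-1 by field.
  have : 0 < (32 * m)^-1 by rewrite invr_gt0; lra.
  move: h1 h2; set y := `|wedge (v n) _| ^- 2;
    set z := `|wedge (v n.+1) _| ^- 2; set x := (32 * m)^-1.
  by clearbody x y z; lra.
exists alpha, (fun i => v (i.*2).+1); split => //.
- move=> i j eij.
  have w0 : wedge (v (i.*2).+1) (v (j.*2).+1) = 0.
    apply/eqP; rewrite -normr_eq0 -slope_dist; [|exact: vn0..].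
    by rewrite eij subrr normr0 mul0r.
  have hij : `|(v (i.*2).+1).2| = `|(v (j.*2).+1).2|.
    by have [->|->] := parallel_cusp_vectors (vV _) (vV _) w0; rewrite //= normrN.
  have hlt a b : (a < b)%N -> `|(v a.+1).2| < `|(v b.+1).2|.
    have st m : `|(v m.+1).2| < `|(v m.+2).2|.
      have := height_double v0 W32 gap m.
      have : 0 < `|(v m.+1).2| by rewrite normr_gt0.
      lra.
    by elim: b => // b ih; rewrite ltnS leq_eqVlt => /predU1P[->//|/ih/lt_trans]; exact.
  have [ij|ji|//] := ltngtP i j.
    by have := hlt i.*2 j.*2; rewrite ltn_double ij hij ltxx => /(_ isT).
  by have := hlt j.*2 i.*2; rewrite ltn_double ji hij ltxx => /(_ isT).
- move=> i; have := val i.*2; rewrite gapE => h1; have h2 := gap1 i.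
  have h3 := err i i.*2; rewrite doubleK leqnn in h3; have {}h3 := h3 isT.
  have := ler_distD (pdist (1, 0) (act (SL2_inv (P i)) (1, 0)) (act (Q i) (1, 0)))
    (pdist (v (i.*2).+1) (1, 0) (alpha, 1)) (l i).
  have -> : i.+1%:R^-1 = (2 * i.+1%:R)^-1 + (2 * i.+1%:R)^-1 :> R by field.
  move: h2 h3; set e := (_ * _)^-1; clearbody e.
  lra.
move=> u Vu u0; have [[n un]|nou] := pselect (exists n, wedge u (v n) = 0); last first.
  right; have un n : wedge u (v n) != 0 by apply/eqP => e; apply: nou; exists n.
  have [a b] := other_values_bounded c00 k0 cusp_vectors_gap v0 vV W32 lnk gap
    alim Vu u0 un.
  split => //; apply: (le_trans b); rewrite lerDl addr_ge0//.
case: n un => [|n un].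
  by rewrite v0 wedgeC wedge_infty => /eqP; rewrite oppr_eq0 (negPf u0).
have [i [ni|ni]] := parity n; first by left; exists i; rewrite -ni.
right; have vu : pdist u (1, 0) (alpha, 1) = pdist (v n.+1) (1, 0) (alpha, 1) /\
    (wedge (alpha, 1) u == 0) = (wedge (alpha, 1) (v n.+1) == 0).
  have [->//|->] := parallel_cusp_vectors Vu (vV _) un.
  have oppw p : wedge p (- (v n.+1).1, - (v n.+1).2) = - wedge p (v n.+1).
    by rewrite /wedge/=; ring.
  by rewrite /pdist !oppw !normrN oppr_eq0.
have [-> wu] := vu; split.
  by rewrite wu; have [] := end_bounds v0 W32 gap alim n.+1.
rewrite ni; have := val (i.*2).+1; rewrite gapO => h1.
have h2 := err 0%N (i.*2).+1 (leq0n _).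
have /andP[_ h3] := gap2 i.
have h4 : 0 < 4 / k by rewrite divr_gt0.
have h5 := ler_norm (pdist (v (i.*2).+2) (1, 0) (alpha, 1) -
  pdist (1, 0) (act (SL2_inv (Q i)) (1, 0)) (act (P i.+1) (1, 0))).
rewrite mulr1 in h2.
lra.
Qed.

End targets.

End sequences.

(** * One-dimensional changes of variables *)

Section one_dim.
Variable R : realType.
Local Notation mu := (@lebesgue_measure R).
Implicit Types B : set R.

Lemma measurable_affine (k b : R) : measurable_fun setT (fun u : R => k * u + b).
Proof. by apply: measurable_funD => //; exact: measurable_funM. Qed.

Lemma lebesgue_affine (k b : R) B : 0 < k -> measurable B ->
  mu B = (k%:E * mu [set u | B (k * u + b)%R])%E.
Proof.
move=> k0 mB; pose f : R -> measurableTypeR R := fun u => k * u + b.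
have mf : measurable_fun setT f by exact: measurable_affine.
have knn : 0 <= k by exact: ltW.
have := @lebesgue_measure_unique R (mscale (NngNum knn) (pushforward mu f)).
move=> /(_ mf _ _ mB); apply.
move=> _ [[p q] _ <-]; rewrite /mscale /pushforward.
transitivity (k%:E * mu (`]((p - b) / k)%R, ((q - b) / k)%R])%classic)%E; last first.
  congr (_ * mu _)%E.
  by apply/seteqP; split=> x /=; rewrite /f !in_itv/= ltr_pdivrMr//
    ler_pdivlMr// ![x * k]mulrC ltrBlDr lerBrDr.
rewrite !lebesgue_measure_itv/= !lte_fin ltr_pM2r ?invr_gt0// ltrD2r.
case: ifPn => _; last by rewrite mule0.
by rewrite -!EFinB -EFinM; congr EFin; field; rewrite gt_eqF.
Qed.

Lemma lebesgue_reflect (b : R) B : measurable B ->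
  mu [set u | B (b - u)] = mu B.
Proof.
move=> mB; rewrite [RHS](@lebesgue_affine 1 b)// mul1e.
rewrite -[RHS]lebesgue_measureN /pushforward//=.
  by congr (mu _); apply/seteqP; split=> x /=; rewrite mul1r addrC.
rewrite -[X in measurable X]setTI; exact: (measurable_affine 1 b).
Qed.

Lemma lebesgue_affineN0 (k b : R) B : k != 0 -> measurable B ->
  mu B = (`|k|%:E * mu [set u | B (k * u + b)%R])%E.
Proof.
move=> k0 mB; have [kgt0|kle0] := ltP 0 k; first by rewrite gtr0_norm -?lebesgue_affine.
have klt0 : 0 < - k by rewrite oppr_gt0 lt_neqAle k0.
rewrite ler0_norm// [LHS](@lebesgue_affine (- k) b)//; congr (_ * _)%E.
rewrite -[LHS](@lebesgue_reflect 0) /=.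
  by congr (mu _); apply/seteqP; split=> x /=; rewrite sub0r mulrNN.
rewrite -[X in measurable X]setTI; exact: (measurable_affine (- k) b).
Qed.

Let pos := [set y : R | 0 < y].

Let mpos : measurable pos.
Proof. by rewrite /pos -set_itvoy. Qed.

Lemma expRNln (y : R) : 0 < y -> expR (- ln y) = y^-1.
Proof. by move=> y0; rewrite expRN lnK. Qed.

Let minv (D : set R) : measurable_fun D (fun y : R => (expR (- ln y))%:E).
Proof.
by apply/measurable_funTS/measurableT_comp => //;
  do 2 apply: measurableT_comp => //.
Qed.

(** The measure dy / y on the positive half-line, transported by the logarithm;
    the weight is written with exp and ln, which are measurable on the whole
    line. *)
Definition log_measure (B : set R) : \bar R :=
  (\int[mu]_(y in pos `&` (@ln R @^-1` B)) (expR (- ln y))%:E)%E.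

Let lm0 : log_measure set0 = 0%E.
Proof. by rewrite /log_measure preimage_set0 setI0 integral_set0. Qed.
Let lm_ge0 B : (0 <= log_measure B)%E.
Proof. by apply: integral_ge0 => y _; rewrite lee_fin expR_ge0. Qed.
Let mln B : measurable B -> measurable (pos `&` (@ln R @^-1` B)).
Proof.
move=> mB; apply: measurableI => //; rewrite -[X in measurable X]setTI.
exact: measurable_ln.
Qed.
Let lm_sa : semi_sigma_additive (log_measure : set (measurableTypeR R) -> _).
Proof.
move=> /= F mF tF mUF; rewrite /log_measure; apply: cvg_toP.
  apply: ereal_nondecreasing_is_cvgn => m n mn.
  apply: lee_sum_nneg_natr => // k _ _; apply: integral_ge0 => /= x Fkx.
  by rewrite lee_fin expR_ge0.
rewrite preimage_bigcup setI_bigcupr ge0_integral_bigcup//=.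
- by move=> k; exact: (mln (mF k)).
- exact: minv.
- move: tF => /trivIsetP tF; apply/trivIsetP => i j _ _ ij.
  rewrite -subset0 => y [[_ Fi] [_ Fj]].
  by have : (F i `&` F j) (ln y) by []; rewrite (tF i j).
Qed.
HB.instance Definition _ := isMeasure.Build _ _ _ 
  (log_measure : set (measurableTypeR R) -> _) lm0 lm_ge0 lm_sa.

(** The measure of an interval is ln (exp q) - ln (exp p) = q - p. *)
Lemma log_measureE B : measurable B -> log_measure B = mu B.
Proof.
move=> mB; apply/esym/(@lebesgue_measure_unique R log_measure) => //.
move=> _ [[p q] _ <-] /=; rewrite /log_measure lebesgue_measure_itv/= lte_fin.
rewrite (_ : _ `&` _ = `]expR p, expR q]%classic); last first.
  apply/seteqP; split=> y /=; rewrite !in_itv/=.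
    by move=> [y0]; rewrite -(ltr_expR p) -(ler_expR (ln y)) lnK// posrE.
  move=> /andP[py yq]; have y0 : 0 < y by rewrite (lt_trans _ py)// expR_gt0.
  by split => //; rewrite -(ltr_expR p) -(ler_expR (ln y)) lnK// py yq.
case: ltP => [pq|qp]; last first.
  by rewrite set_itv_ge ?integral_set0// bnd_simp -leNgt ler_expR.
rewrite integral_itv_obnd_cbnd; last exact: minv.
apply/esym; transitivity (\int[mu]_(y in `[expR p, expR q]) ((y : R)^-1)%:E)%E.
  apply: eq_integral => y; rewrite inE/= in_itv/= => /andP[y1 _].
  by rewrite expRNln// (lt_le_trans _ y1)// ?expR_gt0.
have gt0 (y : R) : expR p <= y -> 0 < y.
  by apply: lt_le_trans; rewrite expR_gt0.
rewrite (@continuous_FTC2 _ _ (@ln R)) ?ltr_expR// ?expRK//.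
- apply: continuous_in_subspaceT => y; rewrite inE/= in_itv/= => /andP[/gt0 y0 _].
  by apply: inv_continuous; rewrite gt_eqF.
- split.
  + move=> y; rewrite in_itv/= => /andP[/ltW/gt0 y0 _].
    by apply: ex_derive; exact: is_derive1_ln.
  + apply: cvg_at_right_filter; exact: continuous_ln (expR_gt0 _).
  + apply: cvg_at_left_filter; exact: continuous_ln (expR_gt0 _).
- move=> y; rewrite in_itv/= => /andP[/ltW/gt0 y0 _].
  by rewrite derive1E; apply: derive_val; exact: is_derive1_ln.
Qed.

End one_dim.

(** * The hyperbolic area in adapted coordinates *)

Section area.
Variable R : realType.
Local Notation mu := (@lebesgue_measure R).
Local Notation plane := (measurableTypeR R * measurableTypeR R)%type.
Implicit Types A : set plane.

Definition area A : \bar R :=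
  (\int[mu \x mu]_(p in A) (p.2 ^- 2)%:E)%E.

Definition upper : set plane := [set p | 0 < p.2].

Lemma measurable_snd_expln D : measurable_fun D (fun p : plane => expR (- ln p.2)).
Proof.
apply: measurable_funTS; apply: measurableT_comp => //.
apply: measurableT_comp => //; apply: measurableT_comp => //.
Qed.

Lemma measurable_chart (e s : R) :
  measurable_fun setT (fun p : plane => (e + s * p.1 * p.2, p.2) : plane).
Proof.
apply: measurable_fun_pair => //; apply: measurable_funD => //.
by apply: measurable_funM => //; exact: measurable_funM.
Qed.

(** In the coordinates x = e + s * u * exp t and y = exp t, the area form
    dx dy / y ^ 2 becomes du dt. *)
Lemma chart_area (e s : R) A : s ^+ 2 = 1 -> measurable A -> A `<=` upper ->
  area A = (\int[mu]_u mu [set t | A (e + s * u * expR t, expR t)%R])%E.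
Proof.
move=> s1 mA Aup.
have n0 : s != 0 by apply: contra_eq_neq s1 => ->; rewrite expr0n eq_sym oner_neq0.
have ns : `|s| = 1 by apply/eqP; rewrite -(@eqrXn2 _ 2)// expr1n -normrX s1 normr1.
transitivity (\int[mu \x mu]_p ((\1_A p)%:E * (expR (- ln p.2) ^+ 2)%:E))%E.
  rewrite /area integral_mkcond; apply: eq_integral => p _.
  rewrite patchE indicE; case: ifPn => pA; last by rewrite mul0e.
  rewrite mul1e expRNln ?exprVn//; apply: Aup; exact: set_mem.
rewrite (@fubini_tonelli2 _ _ _ _ _ mu mu)/=; last 2 first.
- apply: emeasurable_funM; apply/measurable_EFinP => //.
  by apply: measurable_funX; exact: measurable_snd_expln.
- by move=> p; rewrite mule_ge0// lee_fin exprn_ge0// expR_ge0.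
rewrite /fubini_G/=.
pose A2 : set plane := (fun p : plane => (e + s * p.1 * p.2, p.2)) @^-1` A.
have mA2 : measurable A2.
  by rewrite -[A2]setTI; exact: measurable_chart.
transitivity (\int[mu]_y \int[mu]_u ((\1_A2 (u, y))%:E * (expR (- ln y))%:E))%E.
  apply: eq_integral => y _.
  rewrite ge0_integralZr//; last first.
    by apply/measurable_EFinP; apply: measurableT_comp => //; exact: measurable_pair2.
  rewrite ge0_integralZr; last 4 first.
  - exact: measurableT.
  - by apply/measurable_EFinP; apply: measurableT_comp => //; exact: measurable_pair2.
  - by move=> x _; rewrite lee_fin.
  - by rewrite lee_fin expR_ge0.
  have E B : measurable B -> (\int[mu]_x (\1_B (x, y))%:E)%E = mu (ysection B y).
    move=> mB; rewrite -[ysection B y]setIT -integral_indic//; last exact: measurable_ysection.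
    by apply: eq_integral => x _; rewrite !indicE mem_ysection.
  rewrite !E//; have [y0|y0] := ltP 0 y; last first.
    have -> : ysection A y = set0.
      rewrite -subset0 => x; rewrite /ysection/= inE => /Aup.
      by rewrite /upper/= ltNge y0.
    have -> : ysection A2 y = set0.
      rewrite -subset0 => x; rewrite /ysection/= inE => /Aup.
      by rewrite /upper/= ltNge y0.
    by rewrite measure0 !mul0e.
  have sy0 : s * y != 0 by rewrite mulf_neq0// gt_eqF.
  rewrite (@lebesgue_affineN0 _ (s * y) e (ysection A y))//;
    last exact: measurable_ysection.
  rewrite normrM ns mul1r gtr0_norm// (_ : [set u | _] = ysection A2 y); last first.
    apply/seteqP; split=> x; rewrite /ysection/= !inE /A2/= addrC mulrAC//.
  rewrite muleAC -EFinM [RHS]muleC; congr (_%:E * _)%E.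
  by rewrite expRNln//; field; rewrite gt_eqF.
transitivity (\int[mu]_u \int[mu]_y ((\1_A2 (u, y))%:E * (expR (- ln y))%:E))%E.
  apply/esym/(@fubini_tonelli _ _ _ _ _ mu mu
    (fun p : plane => (\1_A2 p)%:E * (expR (- ln p.2))%:E)%E).
  - apply: emeasurable_funM; apply/measurable_EFinP => //.
    exact: measurable_snd_expln.
  - by move=> p; rewrite mule_ge0// lee_fin expR_ge0.
apply: eq_integral => u _.
rewrite -log_measureE; last first.
  have mf : measurable_fun setT (fun t : R => (e + s * u * expR t, expR t) : plane).
    apply: measurable_fun_pair => //; apply: measurable_funD => //.
    by apply: measurable_funM.
  by rewrite -[X in measurable X]setTI; exact: mf.
rewrite /log_measure [RHS]integral_mkcond; apply: eq_integral => y _.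
rewrite patchE indicE; case: ifPn => yin.
  rewrite [_ \in A2]mem_set ?mul1e//.
  by move: yin; rewrite inE /A2/= => -[y0]; rewrite lnK.
case: (boolP (_ \in A2)) => [|_]; last by rewrite mul0e.
rewrite inE /A2/= => Ay; move: yin; rewrite notin_setE/=; apply: contra_notP => _.
have y0 : 0 < y by exact: (Aup _ Ay).
by split => //; rewrite lnK.
Qed.

Definition mobius_den (M : 'M[R]_2) (p : plane) : R :=
  (M 1 0 * p.1 + M 1 1) ^+ 2 + (M 1 0 * p.2) ^+ 2.

(** The transformation of the upper half-plane as a function on the whole
    plane, for use with the product measure. *)
Definition mobius (M : 'M[R]_2) (p : plane) : plane :=
  (((M 0 0 * p.1 + M 0 1) * (M 1 0 * p.1 + M 1 1) + M 0 0 * M 1 0 * p.2 ^+ 2)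
     / mobius_den M p,
   p.2 / mobius_den M p).

Lemma measurable_mobius_preimage (M : SL2 R) A : measurable A ->
  measurable (upper `&` mobius M @^-1` A).
Proof.
move=> mA.
pose f (p : plane) : plane :=
  (((M 0 0 * p.1 + M 0 1) * (M 1 0 * p.1 + M 1 1) + M 0 0 * M 1 0 * p.2 ^+ 2)
     * expR (- ln (mobius_den M p)),
   p.2 * expR (- ln (mobius_den M p))).
have maff (a b : R) : measurable_fun setT (fun p : plane => a * p.1 + b).
  by apply: measurable_funD => //; exact: measurable_funM.
have mden : measurable_fun setT (mobius_den M).
  apply: measurable_funD; first exact: measurable_funX.
  by apply: measurable_funX; exact: measurable_funM.
have mexp : measurable_fun setT (fun p => expR (- ln (mobius_den M p))).
  apply: measurableT_comp => //.
  by apply: measurableT_comp => //; apply: measurableT_comp.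
have mf : measurable_fun setT f.
  apply: measurable_fun_pair; last exact: measurable_funM.
  apply: measurable_funM => //; apply: measurable_funD.
    exact: measurable_funM.
  by apply: measurable_funM => //; exact: measurable_funX.
have mup : measurable upper.
  rewrite (_ : upper = setT `&` snd @^-1` [set y : R | 0 < y]).
    by apply: measurable_snd => //; rewrite -set_itvoy.
  by rewrite setTI.
rewrite (_ : _ `&` _ = upper `&` (setT `&` f @^-1` A)).
  by apply: measurableI => //; exact: mf.
have E p : upper p -> f p = mobius M p.
  move=> p0; rewrite /f !expRNln//.
  exact: (moebius_den_gt0 M (MkUHP p0)).
by rewrite setTI; apply/seteqP; split=> p [p0 Ap]; split => //;
  rewrite /preimage/= ?E// -E.
Qed.

(** With e = - d / c before and e = a / c after the transformation, the
    coordinates of [chart_area] turn it into the map that keeps u and sends t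
    to k(u) - t: a reflection on each line u = constant. *)
Lemma mobius_area_nz (M : SL2 R) A : M 1 0 != 0 -> measurable A -> A `<=` upper ->
  area (upper `&` mobius M @^-1` A) = area A.
Proof.
move=> c0 mA Aup.
rewrite (@chart_area (- (M 1 1 / M 1 0)) 1) ?expr1n//; last first.
  exact: measurable_mobius_preimage.
rewrite (@chart_area (M 0 0 / M 1 0) (-1) A) ?sqrrN ?expr1n//.
apply: eq_integral => u _.
pose k := - ln (M 1 0 ^+ 2 * (1 + u ^+ 2)).
have k0 : 0 < M 1 0 ^+ 2 * (1 + u ^+ 2).
  by rewrite mulr_gt0// ?exprn_even_gt0// ltr_pwDl// sqr_ge0.
have mf : measurable_fun setT
    (fun t : R => (M 0 0 / M 1 0 + -1 * u * expR t, expR t) : plane).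
  by apply: measurable_fun_pair => //; apply: measurable_funD => //; apply: measurable_funM.
rewrite -[RHS](lebesgue_reflect k); last first.
  by rewrite -[X in measurable X]setTI; exact: mf.
congr (mu _); apply/seteqP.
have E t : mobius M (- (M 1 1 / M 1 0) + 1 * u * expR t, expR t)%R =
   (M 0 0 / M 1 0 + -1 * u * expR (k - t), expR (k - t))%R.
  have et := expR_gt0 t.
  have u1 : 1 + u ^+ 2 != 0 by rewrite gt_eqF// ltr_pwDl// sqr_ge0.
  have den : mobius_den M (- (M 1 1 / M 1 0) + 1 * u * expR t, expR t) =
    M 1 0 ^+ 2 * (1 + u ^+ 2) * expR t ^+ 2 by rewrite /mobius_den/=; field.
  have det := det_SL2E M.
  have b : M 0 1 = (M 0 0 * M 1 1 - 1) / M 1 0 by rewrite -det; field.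
  have ekt : expR (k - t) = (M 1 0 ^+ 2 * (1 + u ^+ 2) * expR t)^-1.
    by rewrite expRD /k expRNln// expRN -invfM.
  have e0 : expR t != 0 by rewrite gt_eqF.
  rewrite /mobius den ekt/= b.
  by congr (_, _); field; rewrite c0 e0 u1.
split=> t /=; rewrite E; first by case.
by move=> At; split => //; rewrite /upper/= expR_gt0.
Qed.

End area.

(** * Invariance of the area, and disjoint translates *)

Section packing.
Variable R : realType.
Local Notation mu := (@lebesgue_measure R).
Local Notation plane := (measurableTypeR R * measurableTypeR R)%type.
Local Notation upper := (@upper R).
Implicit Types A : set plane.

Lemma mobius_upper (M : SL2 R) p : upper p -> upper (mobius M p).
Proof.
move=> p0; rewrite /upper/= divr_gt0//.
exact: (moebius_den_gt0 M (MkUHP p0)).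
Qed.

Lemma mobius_mul (M N : SL2 R) p : upper p ->
  mobius (SL2_mul M N) p = mobius M (mobius N p).
Proof.
case: p => x y p0.
have dN : mobius_den N (x, y) != 0.
  by rewrite gt_eqF// (moebius_den_gt0 N (MkUHP p0)).
have dMN : mobius_den (SL2_mul M N) (x, y) != 0.
  by rewrite gt_eqF// (moebius_den_gt0 (SL2_mul M N) (MkUHP p0)).
move: dN dMN (det_SL2E N) (det_SL2E M).
rewrite /mobius /mobius_den !SL2_mulE/=.
set m00 := M 0 0; set m01 := M 0 1; set m10 := M 1 0; set m11 := M 1 1.
set n00 := N 0 0; set n01 := N 0 1; set n10 := N 1 0; set n11 := N 1 1.
set d := (X in X != 0) => dN dMN detN detM.
have yE : y = (n00 * n11 - n01 * n10) * y by rewrite detN mul1r.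
have H : ((m10 * (((n00 * x + n01) * (n10 * x + n11) + n00 * n10 * y ^+ 2) / d)
     + m11) ^+ 2 + (m10 * (y / d)) ^+ 2) =
   (((m10 * n00 + m11 * n10) * x + (m10 * n01 + m11 * n11)) ^+ 2 +
      ((m10 * n00 + m11 * n10) * y) ^+ 2) / d.
  rewrite [in LHS](_ : y / d = (n00 * n11 - n01 * n10) * y / d); last by rewrite -yE.
  by move: dN; rewrite /d => dN; field.
rewrite H; rewrite /d in dN *.
congr (_, _); last by field; rewrite dN dMN.
set w := y / _.
have -> : m00 * m10 * w ^+ 2 = m00 * m10 * ((n00 * n11 - n01 * n10) * w) ^+ 2.
  by rewrite detN mul1r.
by rewrite /w; field; rewrite dN dMN.
Qed.

Lemma mobius_trivial (M : SL2 R) p : M 0 1 = 0 -> M 1 0 = 0 -> M 0 0 = M 1 1 ->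
  mobius M p = p.
Proof.
move=> b c ad; have := det_SL2E M; rewrite /mobius /mobius_den b c ad.
rewrite mul0r subr0 => D.
have a0 : M 1 1 != 0.
  by apply: contra_eq_neq D => ->; rewrite mul0r eq_sym oner_neq0.
by case: p => x y /=; congr (_, _); 
  rewrite !mul0r add0r expr0n addr0/= expr2; [field|rewrite D divr1].
Qed.

Lemma mobiusK (M : SL2 R) p : upper p -> mobius (SL2_inv M) (mobius M p) = p.
Proof.
move=> p0; rewrite -mobius_mul// mobius_trivial//;
  rewrite !SL2_mulE !SL2_invE; have := det_SL2E M; lra.
Qed.

Lemma mobiusKV (M : SL2 R) p : upper p -> mobius M (mobius (SL2_inv M) p) = p.
Proof.
move=> p0; rewrite -mobius_mul// mobius_trivial//;
  rewrite !SL2_mulE !SL2_invE; have := det_SL2E M; lra.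
Qed.

(** A matrix with c = 0 is a product of two matrices with c != 0. *)
Lemma mobius_area (M : SL2 R) A : measurable A -> A `<=` upper ->
  area (upper `&` mobius M @^-1` A) = area A.
Proof.
move=> mA Aup; have [c0|] := eqVneq (M 1 0) 0; last by move=> c0; exact: mobius_area_nz.
(* S is the inversion z |-> - 1 / z. *)
have hS : 0 * 0 - (-1) * 1 = 1 :> R by ring.
pose S := SL2_of hS; pose N := SL2_mul M (SL2_inv S).
have ad := det_SL2E M.
have a0 : M 1 1 != 0.
  by apply: contra_eq_neq ad => ->; rewrite c0 !mulr0 subr0 eq_sym oner_neq0.
have mN := @measurable_mobius_preimage _ N _ mA.
rewrite -[RHS](@mobius_area_nz _ N)//; last first.
  by rewrite SL2_mulE !SL2_invE !SL2_ofE c0 mul0r add0r mulrN1 oppr_eq0.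
rewrite -[RHS](@mobius_area_nz _ S)//; last first.
  by rewrite SL2_ofE oner_neq0.
congr area; apply/seteqP.
have E p : upper p -> mobius N (mobius S p) = mobius M p.
  move=> p0; rewrite -mobius_mul//; congr mobius; congr SL2_mx.
  apply: SL2_eqP; rewrite !SL2_mulE !SL2_invE !SL2_ofE; split; ring.
split=> p [p0]; rewrite /preimage/= ?E//.
  by move=> Ap; split=> //; split=> //; exact: (@mobius_upper S p p0).
by case.
Qed.

Lemma measurable_area_density (D : set plane) : D `<=` upper ->
  measurable_fun D (fun p : plane => (p.2 ^- 2)%:E).
Proof.
move=> Dup; apply/measurable_EFinP.
apply: (@eq_measurable_fun _ _ _ _ _ (fun p : plane => expR (- ln p.2) ^+ 2)).
  by move=> p; rewrite inE => /Dup p0; rewrite expRNln// exprVn.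
by apply: measurable_funX; exact: measurable_snd_expln.
Qed.

Lemma area_bigcup (E : (set plane)^nat) : (forall k, measurable (E k)) ->
  (forall k, E k `<=` upper) -> trivIset setT E ->
  area (\bigcup_k E k) = (\sum_(k <oo) area (E k))%E.
Proof.
move=> mE Eup tE; rewrite /area ge0_integral_bigcup//.
- by apply: measurable_area_density => p [k _]; exact: Eup.
- by move=> p _; rewrite lee_fin invr_ge0 sqr_ge0.
Qed.

Lemma le_area A B : measurable A -> measurable B -> A `<=` B -> B `<=` upper ->
  (area A <= area B)%E.
Proof.
move=> mA mB AB Bup; apply: ge0_subset_integral => //.
  exact: measurable_area_density.
by move=> p _; rewrite lee_fin invr_ge0 sqr_ge0.
Qed.

(** Cut D into countably many pieces according to the first enumerated group
    element that sends a point into F.  The images of the pieces have the same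
    areas, lie in F, and are pairwise disjoint because two points of D in the
    same orbit are equal. *)
Lemma packing_area (Gam : set (SL2 R)) (e : nat -> SL2 R) (F D : set plane) :
  (forall M N, Gam M -> Gam N -> Gam (SL2_mul (SL2_inv M) N)) ->
  (forall k, Gam (e k)) -> (forall M, Gam M -> exists k, e k = M) ->
  measurable F -> F `<=` upper ->
  (forall p, upper p -> exists2 M, Gam M & F (mobius M p)) ->
  measurable D -> D `<=` upper ->
  (forall M p, Gam M -> D p -> D (mobius M p) -> mobius M p = p) ->
  (area D <= area F)%E.
Proof.
move=> Gdiv Ge eG mF Fup Fcov mD Dup Ddisj.
pose P k := upper `&` mobius (e k) @^-1` F.
pose E k := D `&` seqDU P k.
pose C k := upper `&` mobius (SL2_inv (e k)) @^-1` E k.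
have mP k : measurable (P k) by exact: measurable_mobius_preimage.
have mE k : measurable (E k).
  by apply: measurableI => //; apply: seqDU_measurable.
have mC k : measurable (C k) by exact: measurable_mobius_preimage.
have Eup k : E k `<=` upper by move=> p [/Dup].
have -> : D = \bigcup_k E k.
  rewrite -setI_bigcupr -seqDU_bigcup_eq; apply/seteqP; split=> p; last by case.
  move=> Dp; split => //; have [M GM FM] := Fcov p (Dup _ Dp).
  have [k ekM] := eG M GM; exists k => //; split; first exact: Dup.
  by rewrite /preimage/= ekM.
have tE : trivIset setT E.
  apply/trivIsetP => i j _ _ ij; rewrite -subset0 => p [[_ pi] [_ pj]].
  have /trivIsetP/(_ i j I I ij) <- := @trivIset_seqDU _ P; by split.
rewrite area_bigcup//.
have tC : trivIset setT C.
  apply/trivIsetP => i j _ _ ij; rewrite -subset0 => q [[q0 qi] [_ qj]].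
  move: qi qj; rewrite /preimage/=; set pi := mobius _ q; set pj := mobius _ q.
  move=> Ei Ej.
  have pij : pj = mobius (SL2_mul (SL2_inv (e j)) (e i)) pi.
    have upi : upper pi := @mobius_upper (SL2_inv (e i)) q q0.
    by rewrite (@mobius_mul (SL2_inv (e j)) (e i) pi upi) /pi (@mobiusKV (e i) q q0).
  have pe : pj = pi.
    rewrite pij; apply: Ddisj; [exact: Gdiv|by case: Ei|].
    by rewrite -pij; case: Ej.
  have : (E i `&` E j) pi by split => //; rewrite -pe.
  by move/trivIsetP: tE => /(_ i j I I ij) ->.
have -> : (\sum_(k <oo) area (E k) = \sum_(k <oo) area (C k))%E.
  by apply: eq_eseriesr => k _; rewrite mobius_area.
have Cup k : C k `<=` upper by move=> p [].
rewrite -area_bigcup//; apply: le_area => //.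
  exact: bigcup_measurable.
move=> q [k _ [q0 [_]]]; move/(@subset_seqDU _ P k) => [_].
by rewrite /preimage/= mobiusKV.
Qed.

End packing.

(** * Boxes standing on the boundary *)

Section box.
Variable R : realType.
Local Notation mu := (@lebesgue_measure R).
Local Notation plane := (measurableTypeR R * measurableTypeR R)%type.
Local Notation upper := (@upper R).

Definition box (t rho : R) : set plane :=
  `]t - rho, t + rho[%classic `*` `]0, rho[%classic.

Lemma measurable_box t rho : measurable (box t rho).
Proof. by apply: measurableX; exact: measurable_itv. Qed.

Lemma box_upper t rho : box t rho `<=` upper.
Proof. by move=> p [_]; rewrite /= in_itv/= => /andP[]. Qed.

Lemma box_area t rho : 0 < rho -> area (box t rho) = +oo%E.
Proof.
move=> rho0; apply/eqyP => K K0.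
(* The part of the box with eps < y < 2 * eps has area at least
   rho / (2 * eps). *)
pose eps := Num.min (rho / 2) (rho / (2 * K)).
have e0 : 0 < eps by rewrite lt_min !divr_gt0// mulr_gt0.
have e1 : eps <= rho / 2 by rewrite ge_min lexx.
have e2 : eps <= rho / (2 * K) by rewrite ge_min lexx orbT.
pose A : set plane := `]t - rho, t + rho[%classic `*` `]eps, 2 * eps[%classic.
have mA : measurable A by apply: measurableX; exact: measurable_itv.
have AB : A `<=` box t rho.
  move=> p [p1 p2]; split=> //; move: p2; rewrite /= !in_itv/= => /andP[a b].
  by apply/andP; split; lra.
apply: (@le_trans _ _ (area A)); last first.
  by apply: le_area => //; [exact: measurable_box|exact: box_upper].
apply: (@le_trans _ _ (\int[mu \x mu]_(p in A) cst ((4 * eps ^+ 2)^-1)%:E p)%E); last first.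
  apply: ge0_le_integral => //.
  - by move=> p _; rewrite lee_fin invr_ge0 mulr_ge0// sqr_ge0.
  - by apply: measurable_area_density => p /AB /box_upper.
  - move=> p [_]; rewrite /= in_itv/= => /andP[a b].
    have p2 : 0 < p.2 by lra.
    rewrite lee_fin lef_pV2 ?posrE ?mulr_gt0 ?exprn_gt0//.
    have -> : 4 * eps ^+ 2 = (2 * eps) ^+ 2 by ring.
    by rewrite ler_pXn2r// ?nnegrE; lra.
rewrite integral_cst//.
have muA : ((mu \x mu) A = mu `](t - rho)%R, (t + rho)%R[%classic *
    mu `]eps, (2 * eps)%R[%classic)%E.
  by rewrite product_measure1E//; exact: measurable_itv.
rewrite [X in (_ <= _ * X)%E]muA.
rewrite !lebesgue_measure_itv/= !lte_fin ifT; last by lra.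
rewrite ifT; last by lra.
rewrite -!EFinB -!EFinM lee_fin.
have -> : (4 * eps ^+ 2)^-1 * ((t + rho - (t - rho)) * (2 * eps - eps)) =
  rho / (2 * eps) by field; rewrite gt_eqF.
by move: e2; rewrite !ler_pdivlMr ?mulr_gt0//; lra.
Qed.

(** A consequence of M p = q, for p and q in the box, in polynomial form: the
    real part of q (c p + d) = a p + b. *)
Definition maps_within (M : SL2 R) t rho :=
  exists p q, [/\ box t rho p, box t rho q &
    q.1 * (M 1 0 * p.1 + M 1 1) - M 1 0 * q.2 * p.2 = M 0 0 * p.1 + M 0 1].

Lemma maps_within_mobius (M : SL2 R) t rho p : box t rho p ->
  box t rho (mobius M p) -> maps_within M t rho.
Proof.
move=> Bp Bq; exists p, (mobius M p); split => //.
have d0 : mobius_den M p != 0.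
  by rewrite gt_eqF// (moebius_den_gt0 M (MkUHP (box_upper Bp))).
rewrite /mobius/=; move: d0; rewrite /mobius_den => d0.
have D : M 0 0 * M 1 1 = 1 + M 0 1 * M 1 0 by rewrite -(det_SL2E M); ring.
by field: D; rewrite d0.
Qed.

Lemma boxS t rho t' rho' : `|t' - t| + rho' <= rho -> box t' rho' `<=` box t rho.
Proof.
move=> h [x y] [/= p1 p2]; rewrite in_itv/= in p1; rewrite in_itv/= in p2.
have := ler_norm (t' - t); have := ler_norm (- (t' - t)); rewrite normrN => h1 h2.
move: p1 p2 => /andP[? ?] /andP[? ?].
by split; rewrite /= in_itv/=; apply/andP; split; lra.
Qed.

Lemma maps_withinS (M : SL2 R) t rho t' rho' : `|t' - t| + rho' <= rho ->
  maps_within M t' rho' -> maps_within M t rho.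
Proof.
by move=> /boxS sub [p [q [Bp Bq e]]]; exists p, q; split => //; exact: sub.
Qed.

Definition acts_trivially (M : SL2 R) := [/\ M 0 1 = 0, M 1 0 = 0 & M 0 0 = M 1 1].

(** If x and x' are close to t and the heights are small, the relation almost
    says that t is a fixed point of the matrix on the boundary. *)
Lemma fixed_point_estimate (a b c d t rho x y x' y' : R) : rho <= 1 ->
  t - rho < x -> x < t + rho -> 0 < y -> y < rho ->
  t - rho < x' -> x' < t + rho -> 0 < y' -> y' < rho ->
  x' * (c * x + d) - c * y' * y = a * x + b ->
  `|c * t ^+ 2 + (d - a) * t - b| <=
    (`|c| * (2 * `|t| + 2) + `|a| + `|d| + 1) * rho.
Proof.
move=> r1 x1 x2 y1 y2 x'1 x'2 y'1 y'2 e.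
pose u := x - t; pose v := x' - t.
have nu : `|u| <= rho by rewrite ler_norml /u; apply/andP; split; lra.
have nv : `|v| <= rho by rewrite ler_norml /v; apply/andP; split; lra.
have ny : `|y| <= rho by rewrite gtr0_norm// ltW.
have ny' : `|y'| <= rho by rewrite gtr0_norm// ltW.
have E : c * t ^+ 2 + (d - a) * t - b =
    a * u - d * v - c * (t * u + t * v + u * v - y * y').
  have -> : b = x' * (c * x + d) - c * y' * y - a * x by rewrite e; ring.
  by rewrite /u /v; ring.
have r0 : 0 <= rho by lra.
rewrite E (le_trans (ler_normB _ _))// normrM.
have h1 : `|a * u - d * v| <= `|a| * rho + `|d| * rho.
  by rewrite (le_trans (ler_normB _ _))// !normrM lerD// ler_wpM2l.
have h2 : `|t * u + t * v + u * v - y * y'| <= (2 * `|t| + 2) * rho.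
  have a1 : `|y * y'| <= rho * 1 by rewrite normrM ler_pM// (le_trans ny').
  have a2 : `|u * v| <= rho * 1 by rewrite normrM ler_pM// (le_trans nv).
  have a3 : `|t * u| <= `|t| * rho by rewrite normrM ler_wpM2l.
  have a4 : `|t * v| <= `|t| * rho by rewrite normrM ler_wpM2l.
  have := ler_normB (t * u + t * v + u * v) (y * y').
  have := ler_normD (t * u + t * v) (u * v).
  have := ler_normD (t * u) (t * v).
  lra.
have h3 : `|c| * `|t * u + t * v + u * v - y * y'| <= `|c| * ((2 * `|t| + 2) * rho).
  by rewrite ler_wpM2l.
lra.
Qed.

(** A matrix that does not act trivially has at most two fixed points on the
    boundary; take a smaller box at a boundary point that is not fixed. *)
Lemma shrink_away (M : SL2 R) t rho : 0 < rho -> ~ acts_trivially M ->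
  exists t' rho', [/\ 0 < rho', `|t' - t| + rho' <= rho & ~ maps_within M t' rho'].
Proof.
move=> rho0 ntM.
pose P x := M 1 0 * x ^+ 2 + (M 1 1 - M 0 0) * x - M 0 1.
(* A quadratic polynomial vanishing at t - rho / 2, t and t + rho / 2 is 0. *)
have [t' tt' Pt'] : exists2 t', `|t' - t| <= rho / 2 & P t' != 0.
  apply: contrapT => no; apply: ntM.
  have Z x : `|x - t| <= rho / 2 -> P x = 0.
    by move=> xt; apply/eqP; apply: contrapT => /negP Px; apply: no; exists x.
  have h0 : P t = 0 by apply: Z; rewrite subrr normr0; lra.
  have h1 : P (t + rho / 2) = 0 by apply: Z; rewrite addrC addKr gtr0_norm; lra.
  have h2 : P (t - rho / 2) = 0 by apply: Z; rewrite addrC addKr normrN gtr0_norm; lra.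
  have c0 : M 1 0 = 0.
    have : M 1 0 * (rho ^+ 2 / 2) = 0.
      have -> : M 1 0 * (rho ^+ 2 / 2) = P (t + rho / 2) + P (t - rho / 2) - 2 * P t.
        by rewrite /P; field.
      by rewrite h0 h1 h2; ring.
    by move/eqP; rewrite mulf_eq0 (gt_eqF (_ : 0 < rho ^+ 2 / 2)) ?orbF => [/eqP//|];
      rewrite divr_gt0// exprn_gt0.
  have da : (M 1 1 - M 0 0) * (rho / 2) = 0.
    have -> : (M 1 1 - M 0 0) * (rho / 2) = P (t + rho / 2) - P t.
      by rewrite /P c0; field.
    by rewrite h0 h1; ring.
  have da0 : M 1 1 - M 0 0 = 0.
    by move/eqP: da; rewrite mulf_eq0 (gt_eqF (_ : 0 < rho / 2)) ?orbF => [/eqP//|]; lra.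
  by split => //; [move: h0; rewrite /P c0 da0|]; lra.
pose m := `|M 1 0| * (2 * `|t'| + 2) + `|M 0 0| + `|M 1 1| + 1.
have m0 : 0 < m by rewrite ltr_wpDl// !addr_ge0// mulr_ge0// addr_ge0// mulr_ge0.
pose rho' := Num.min (Num.min (rho / 2) 1) (`|P t'| / (2 * m)).
have r0 : 0 < rho' by rewrite !lt_min ltr01 !divr_gt0// ?normr_gt0// mulr_gt0.
have r1 : rho' <= rho / 2 by rewrite !ge_min lexx.
have r2 : rho' <= 1 by rewrite !ge_min lexx orbT.
have r3 : rho' <= `|P t'| / (2 * m) by rewrite !ge_min lexx orbT.
exists t', rho'; split => //; first lra.
move=> [[x y] [[x' y'] [[/= p1 p2] [/= q1 q2] /= e]]].
move: p1 p2 q1 q2; rewrite !in_itv/= => /andP[p1 p2] /andP[p3 p4] /andP[q1 q2] /andP[q3 q4].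
have : `|P t'| <= m * rho' by exact: fixed_point_estimate e.
move: r3; rewrite ler_pdivlMr ?mulr_gt0// => r3.
have : 0 < `|P t'| by rewrite normr_gt0.
lra.
Qed.

Lemma shrink_away_seq (l : seq (SL2 R)) t rho : 0 < rho ->
  (forall M, M \in l -> ~ acts_trivially M) ->
  exists t' rho', [/\ 0 < rho', `|t' - t| + rho' <= rho &
    forall M, M \in l -> ~ maps_within M t' rho'].
Proof.
move=> rho0; elim: l => [_|M l ih nt].
  by exists t, rho; split => //; rewrite subrr normr0 add0r.
have [|t1 [rho1 [r1 h1 H1]]] := ih.
  by move=> N Nl; apply: nt; rewrite inE Nl orbT.
have [|t2 [rho2 [r2 h2 H2]]] := @shrink_away M t1 rho1 r1.
  by apply: nt; rewrite inE eqxx.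
exists t2, rho2; split => //.
  have := ler_distD t1 t2 t; lra.
move=> N; rewrite inE => /predU1P[->//|Nl] h.
exact: (H1 _ Nl (maps_withinS h2 h)).
Qed.

End box.

(** * The orbit of a cusp of a lattice is dense *)

Section density.
Variable R : realType.
Local Notation plane := (measurableTypeR R * measurableTypeR R)%type.
Local Notation upper := (@upper R).

(** Here u and u / den stand for the real parts of c z + d and of its inverse
    a - c w, where w = M z.  If neither is small relative to c, then their
    product, which is at most 1, bounds everything. *)
Lemma inverse_pair_bounds (c u den r c0 : R) : 0 < r -> 0 < c0 -> c0 <= `|c| ->
  u ^+ 2 <= den -> `|c| * (r / 2) <= `|u| -> `|c| * (r / 2) <= `|u / den| ->
  [/\ `|c| <= 2 / r, `|u| <= 2 / (c0 * r) & `|u / den| <= 2 / (c0 * r)].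
Proof.
move=> r0 c00 cc ud h1 h2.
have c1 : 0 < `|c| by exact: lt_le_trans cc.
have m0 : 0 < `|c| * (r / 2) by rewrite mulr_gt0// divr_gt0.
have u0 : 0 < `|u| by exact: lt_le_trans h1.
have den0 : 0 < den.
  by apply: lt_le_trans ud; rewrite exprn_even_gt0//= -normr_gt0.
have prod : `|u| * `|u / den| <= 1.
  rewrite -normrM mulrA -expr2 ger0_norm ?divr_ge0 ?sqr_ge0 ?(ltW den0)//.
  by rewrite ler_pdivrMr// mul1r.
have v0 : 0 < `|u / den| by exact: lt_le_trans h2.
have cr0 : 0 < c0 * r by rewrite mulr_gt0.
have crc : c0 * r <= `|c| * r by rewrite ler_wpM2r// ltW.
split.
- rewrite ler_pdivlMr//.
  have : (`|c| * (r / 2)) * (`|c| * (r / 2)) <= 1.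
    by apply: le_trans prod; rewrite ler_pM// ltW.
  by rewrite -expr2 expr_le1 ?(ltW m0)//; lra.
- rewrite ler_pdivlMr//.
  have : `|u| * (`|c| * (r / 2)) <= 1.
    by apply: le_trans prod; rewrite ler_wpM2l.
  have : `|u| * (c0 * r) <= `|u| * (`|c| * r) by rewrite ler_wpM2l.
  lra.
- rewrite ler_pdivlMr//.
  have : `|u / den| * (`|c| * (r / 2)) <= 1.
    by apply: le_trans prod; rewrite mulrC ler_wpM2r.
  have : `|u / den| * (c0 * r) <= `|u / den| * (`|c| * r) by rewrite ler_wpM2l.
  lra.
Qed.

Variable Gam : set (SL2 R).
Hypothesis Gam1 : Gam (SL2_one R).
Hypothesis GamM : forall M N, Gam M -> Gam N -> Gam (SL2_mul M N).
Hypothesis GamV : forall M, Gam M -> Gam (SL2_inv M).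
Hypothesis Gdisc : isolated_one Gam.
Variable tau : R.
Hypothesis tau0 : tau != 0.
Hypothesis Gtau : has_translation Gam tau.

Lemma far_from_zero (c x s r y : R) : c != 0 -> r <= `|x / c - s| -> `|y - s| < r / 2 ->
  `|c| * (r / 2) <= `|c * y - x|.
Proof.
move=> c0 h1 h2.
have -> : c * y - x = c * (y - x / c) by field.
rewrite normrM ler_wpM2l//.
have := ler_distD y (x / c) s.
rewrite [`|x / c - y|]distrC; lra.
Qed.

(** If no cusp lies within r of s, then - d / c and a / c are at least r away
    from s, so that [inverse_pair_bounds] applies to z and M z in a small box
    at s. *)
Lemma recurrent_bounded (s r : R) : 0 < r ->
  (forall M, Gam M -> M 1 0 != 0 -> r <= `|M 0 0 / M 1 0 - s|) ->
  exists B : R, forall M p, Gam M -> box s (Num.min (r / 2) 1) p ->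
    box s (Num.min (r / 2) 1) (mobius M p) -> forall i j, `|M i j| <= B.
Proof.
move=> r0 H; have [c0 c00 Hc0] := lower_left_gap Gam1 GamM GamV Gdisc tau0 Gtau.
pose D := 2 / (c0 * r) + 2 / r * (`|s| + 1).
have t1 : 0 < 2 / (c0 * r) by rewrite divr_gt0// mulr_gt0.
have t2 : 0 < 2 / r by rewrite divr_gt0.
have D0 : 0 <= D by rewrite addr_ge0 ?(ltW t1)// mulr_ge0 ?(ltW t2)// addr_ge0.
pose B := 1 + 2 * (`|s| + 1) + 2 / r + D + (D ^+ 2 + 1) / c0; exists B.
have B1 := ltW t2.
have B2 : 0 <= (D ^+ 2 + 1) / c0 by rewrite divr_ge0 ?(ltW c00)// addr_ge0 ?sqr_ge0.
have s0 := normr_ge0 s.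
have Bge z : [\/ z <= 1 + 2 * (`|s| + 1), z <= 2 / r, z <= D |
    z <= (D ^+ 2 + 1) / c0] -> z <= B.
  by rewrite /B; case; lra.
suff main (M : SL2 R) p : Gam M -> box s (Num.min (r / 2) 1) p ->
    box s (Num.min (r / 2) 1) (mobius M p) ->
    [/\ `|M 0 0| <= B, `|M 0 1| <= B, `|M 1 0| <= B & `|M 1 1| <= B].
  move=> M p GM Bp Bq i j; have [b1 b2 b3 b4] := main M p GM Bp Bq.
  by case: (ord2P i) (ord2P j) => -> [] ->.
case: p => x y GM.
pose den := mobius_den M (x, y).
pose q1 := ((M 0 0 * x + M 0 1) * (M 1 0 * x + M 1 1) + M 0 0 * M 1 0 * y ^+ 2) / den.
have mobE : mobius M (x, y) = (q1, y / den) by [].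
rewrite mobE => -[/= Bx By] [/= Bq1 Bq2].
have y0 : 0 < y by move: By; rewrite in_itv/= => /andP[].
have den0 : 0 < den by exact: (moebius_den_gt0 M (MkUHP (y0 : 0 < (x, y).2))).
have ad : M 0 0 * M 1 1 = 1 + M 0 1 * M 1 0 by rewrite -(det_SL2E M); ring.
pose u := M 1 0 * x + M 1 1.
have ud : u ^+ 2 <= den by rewrite /den /mobius_den/= lerDl sqr_ge0.
have q1E : M 0 0 - M 1 0 * q1 = u / den.
  move: (den0); rewrite /q1 /u /den /mobius_den/= => /lt0r_neq0 dn.
  by field: ad; rewrite dn.
have bE : M 1 0 = 0 -> M 0 1 = q1 * M 1 1 - M 0 0 * x.
  move=> z; move: (ad); rewrite z mulr0 addr0 => ad1.
  have d0 : M 1 1 != 0 by apply: contra_eq_neq ad1 => ->; rewrite mulr0 eq_sym oner_neq0.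
  rewrite /q1 /den /mobius_den/= z !mul0r !mulr0 mul0r !add0r expr0n/= !addr0.
  by field.
have m1 : Num.min (r / 2) 1 <= r / 2 by rewrite ge_min lexx.
have m2 : Num.min (r / 2) 1 <= 1 by rewrite ge_min lexx orbT.
clearbody q1 den.
have xs : `|x - s| < r / 2 /\ `|x| <= `|s| + 1.
  have h : `|x - s| < Num.min (r / 2) 1.
    by move: Bx; rewrite in_itv/= => /andP[a b]; rewrite ltr_norml; apply/andP; split; lra.
  have := ler_normD (x - s) s; rewrite subrK; split; lra.
have qs : `|q1 - s| < r / 2 /\ `|q1| <= `|s| + 1.
  have h : `|q1 - s| < Num.min (r / 2) 1.
    by move: Bq1; rewrite in_itv/= => /andP[a b]; rewrite ltr_norml; apply/andP; split; lra.
  have := ler_normD (q1 - s) s; rewrite subrK; split; lra.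
have [x1 x2] := xs; have [q1' q2'] := qs.
have [c0'|c0'] := eqVneq (M 1 0) 0.
  have a2 := stabilizer_square GamM GamV Gdisc tau0 Gtau GM c0'.
  have na : `|M 0 0| = 1 by apply/eqP; rewrite -(@eqrXn2 _ 2)// expr1n -normrX a2 normr1.
  have adE : M 1 1 = M 0 0.
    by move: ad; rewrite c0' mulr0 addr0 => ad1; rewrite -[LHS]mul1r -a2 expr2 -mulrA ad1 mulr1.
  have uE : u = M 0 0 by rewrite /u c0' adE mul0r add0r.
  have b1 : `|M 0 1| <= 2 * (`|s| + 1).
    rewrite (bE c0') adE (le_trans (ler_normB _ _))// !normrM na; lra.
  by rewrite c0' normr0 adE na; split; apply: Bge; apply: Or41; lra.
have [|cc] := Hc0 M GM; first by move/eqP; rewrite (negPf c0').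
have h1 : `|M 1 0| * (r / 2) <= `|u|.
  rewrite /u -[M 1 1]opprK; apply: (@far_from_zero _ _ s) => //.
  have := H _ (GamV GM); rewrite !SL2_invE oppr_eq0 => /(_ c0').
  by rewrite invrN mulrN mulNr.
have h2 : `|M 1 0| * (r / 2) <= `|u / den|.
  rewrite -q1E distrC; apply: (@far_from_zero _ _ s) => //.
  exact: H.
have [k1 k2 k3] := inverse_pair_bounds r0 c00 cc ud h1 h2.
have hx (z : R) : `|z| <= `|s| + 1 -> `|M 1 0 * z| <= 2 / r * (`|s| + 1).
  by move=> hz; rewrite normrM ler_pM.
have d1 : `|M 1 1| <= D.
  have -> : M 1 1 = u - M 1 0 * x by rewrite /u; ring.
  by rewrite (le_trans (ler_normB _ _))// lerD// hx.
have a1 : `|M 0 0| <= D.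
  have -> : M 0 0 = u / den + M 1 0 * q1 by rewrite -q1E; ring.
  by rewrite (le_trans (ler_normD _ _))// lerD// hx.
have b1 : `|M 0 1| <= (D ^+ 2 + 1) / c0.
  rewrite ler_pdivlMr//.
  have : `|M 0 1| * c0 <= `|M 0 1 * M 1 0| by rewrite normrM ler_wpM2l.
  have -> : M 0 1 * M 1 0 = M 0 0 * M 1 1 - 1 by rewrite ad; ring.
  have := ler_normB (M 0 0 * M 1 1) 1; rewrite normr1 normrM.
  have : `|M 0 0| * `|M 1 1| <= D ^+ 2 by rewrite expr2 ler_pM.
  lra.
by split; apply: Bge; [exact: Or43|exact: Or44|exact: Or42|exact: Or43].
Qed.

(** Suppose that no cusp lies within r of s.  Only finitely many elements of
    the group can move a point of a small box at s into the box, so a smaller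
    box is disjoint from its translates by all elements acting non-trivially.
    Its area is infinite but at most the area of F. *)
Theorem cusp_dense (F : set plane) : measurable F -> F `<=` upper ->
  (area F < +oo)%E ->
  (forall p, upper p -> exists2 M, Gam M & F (mobius M p)) ->
  forall s r : R, 0 < r ->
    exists M, [/\ Gam M, M 1 0 != 0 & `|M 0 0 / M 1 0 - s| < r].
Proof.
move=> mF Fup Foo Fcov s r r0; apply: contrapT => no.
have H M : Gam M -> M 1 0 != 0 -> r <= `|M 0 0 / M 1 0 - s|.
  by move=> GM c0; rewrite leNgt; apply/negP => lt; apply: no; exists M.
have [B HB] := recurrent_bounded r0 H.
have rho0 : 0 < Num.min (r / 2) 1 by rewrite lt_min ltr01 divr_gt0.
have [l lE] := (finite_seqP _).1 (bounded_finite GamM GamV Gdisc B).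
pose l' := [seq M <- l | `[< ~ acts_trivially M >]].
have [|t [rho [rho1 sub Hl]]] := @shrink_away_seq R l' s _ rho0.
  by move=> M; rewrite mem_filter => /andP[/asboolP].
have [e Ge eG] := discrete_enumerable Gam1 GamM GamV Gdisc.
have : (area (box t rho) <= area F)%E.
  apply: (@packing_area _ Gam e) => //.
  - by move=> M N GM GN; apply: GamM => //; exact: GamV.
  - exact: measurable_box.
  - exact: box_upper.
  - move=> M p GM Bp Bq.
    have [[b c ad]|nt] := pselect (acts_trivially M); first exact: mobius_trivial.
    exfalso; apply: (Hl M _ (maps_within_mobius Bp Bq)).
    have sb : box t rho `<=` box s (Num.min (r / 2) 1) by exact: boxS.
    rewrite mem_filter; apply/andP; split; first exact/asboolP.
    have : [set M | Gam M /\ forall i j, `|M i j| <= B] M.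
      by split => //; apply: HB (sb _ Bp) (sb _ Bq).
    by rewrite lE.
by rewrite box_area// leye_eq => /eqP E; move: Foo; rewrite E ltxx.
Qed.

End density.

(** * From PSL(2,R) to matrices *)

Section matrix_groups.
Variable R : realType.
Implicit Types (G : set (PSL2 R)) (M N A : SL2 R).

Definition matrix_group G : set (SL2 R) := [set M | G (\pi_(PSL2 R) M)].

Lemma matrix_group_one G : subgroup G -> matrix_group G (SL2_one R).
Proof. by case. Qed.

Lemma matrix_group_mul G M N : subgroup G -> matrix_group G M ->
  matrix_group G N -> matrix_group G (SL2_mul M N).
Proof. by move=> [_ GM _] Mg Ng; rewrite /matrix_group/= -PSL2_mul_pi; exact: GM. Qed.

Lemma matrix_group_inv G M : subgroup G -> matrix_group G M -> matrix_group G (SL2_inv M).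
Proof. by move=> [_ _ GV] Mg; rewrite /matrix_group/= -PSL2_inv_pi; exact: GV. Qed.

Lemma matrix_group_isolated_one G : subgroup G -> G `<=` isolated G ->
  isolated_one (matrix_group G).
Proof.
move=> [G1 _ _] /(_ _ G1)[_ [U U1 UG]].
have : nbhs (SL2_one R) (\pi_(PSL2 R) @^-1` U).
  by apply: (@pi_continuous _ {eq_quot (@SL2_pm R)} (SL2_one R)).
rewrite nbhsE/= => -[B [[W oW WB] B1] BU].
have : nbhs (1 : 'M[R]_2) W.
  by apply: open_nbhs_nbhs; split => //; move: B1; rewrite -WB.
move=> /nbhs_ballP[eps /= eps0 epsW].
exists (Num.min eps 1); first by rewrite lt_min eps0 ltr01.
move=> M GM; rewrite !lt_min => /andP[a1 a2] /andP[b1 _] /andP[c1 _] /andP[d1 d2].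
have UM : U (\pi_(PSL2 R) M).
  apply: BU; rewrite -WB; apply: epsW; rewrite /ball/= /mx_ball; split => // i j.
  by rewrite /ball/= mxE; case: (ord2P i) (ord2P j) => -> [] ->;
    rewrite /= ?subr0 ?sub0r ?normrN // distrC.
have : [set 1%g] (\pi_(PSL2 R) M) by rewrite -UG; split.
move=> /= /PSL2_piP; rewrite /SL2_pm => /orP[]/eqP E.
  exact/val_inj.
have : M 0 0 = -1 by rewrite E /= !mxE.
by move=> M00; move: a2; rewrite M00 ltr_norml ltrDl oppr_gt0 ltr10.
Qed.

Lemma conj_cancel A M :
  SL2_mul (SL2_mul A (SL2_mul (SL2_mul (SL2_inv A) M) A)) (SL2_inv A) = M.
Proof.
apply/val_inj; rewrite /= !mulrA mulrV ?unit_SL2// mul1r -mulrA mulrV ?unit_SL2//.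
by rewrite mulr1.
Qed.

Lemma conj_cancelV A M :
  SL2_mul (SL2_mul (SL2_inv A) (SL2_mul (SL2_mul A M) (SL2_inv A))) A = M.
Proof.
apply/val_inj; rewrite /= !mulrA mulVr ?unit_SL2// mul1r -mulrA mulVr ?unit_SL2//.
by rewrite mulr1.
Qed.

Lemma conj_isolated_one (Gam : set (SL2 R)) A : isolated_one Gam ->
  isolated_one [set M | Gam (SL2_mul (SL2_mul (SL2_inv A) M) A)].
Proof.
move=> [eps e0 He].
pose B := `|A 0 0| + `|A 0 1| + `|A 1 0| + `|A 1 1| + 1.
have B1 : 1 <= B by rewrite lerDr !addr_ge0.
have BB : 0 < 4 * (B * B) by rewrite !mulr_gt0//; lra.
have [A00 A01 A10 A11] : [/\ `|A 0 0| <= B, `|A 0 1| <= B, `|A 1 0| <= B & `|A 1 1| <= B].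
  have := normr_ge0 (A 0 0); have := normr_ge0 (A 0 1).
  have := normr_ge0 (A 1 0); have := normr_ge0 (A 1 1).
  by rewrite /B; split; lra.
have D : A 0 0 * A 1 1 = 1 + A 0 1 * A 1 0 by rewrite -(det_SL2E A); ring.
exists (eps / (4 * (B * B))); first exact: divr_gt0.
move=> M GM h00 h01 h10 h11.
have bd (x1 y1 e1 x2 y2 e2 x3 y3 e3 x4 y4 e4 : R) : `|x1| <= B -> `|y1| <= B ->
   `|x2| <= B -> `|y2| <= B -> `|x3| <= B -> `|y3| <= B -> `|x4| <= B -> `|y4| <= B ->
   `|e1| < eps / (4 * (B * B)) -> `|e2| < eps / (4 * (B * B)) ->
   `|e3| < eps / (4 * (B * B)) -> `|e4| < eps / (4 * (B * B)) ->
   `|x1 * y1 * e1 + x2 * y2 * e2 + x3 * y3 * e3 + x4 * y4 * e4| < eps.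
  move=> X1 Y1 X2 Y2 X3 Y3 X4 Y4 E1 E2 E3 E4.
  have t (x y e : R) : `|x| <= B -> `|y| <= B -> `|e| < eps / (4 * (B * B)) ->
      `|x * y * e| < eps / 4.
    move=> X Y E; rewrite !normrM.
    apply: (@le_lt_trans _ _ (B * B * `|e|)).
      by rewrite ler_wpM2r// ler_pM.
    by move: E; rewrite ltr_pdivlMr//; lra.
  rewrite (le_lt_trans (ler_normD _ _))//.
  have := ler_normD (x1 * y1 * e1 + x2 * y2 * e2) (x3 * y3 * e3).
  have := ler_normD (x1 * y1 * e1) (x2 * y2 * e2).
  have := t _ _ _ X1 Y1 E1; have := t _ _ _ X2 Y2 E2.
  have := t _ _ _ X3 Y3 E3; have := t _ _ _ X4 Y4 E4.
  lra.
have C1 : SL2_mul (SL2_mul (SL2_inv A) M) A = SL2_one R.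
  apply: He => //.
  - have -> : SL2_mul (SL2_mul (SL2_inv A) M) A 0 0 - 1 =
      A 1 1 * A 0 0 * (M 0 0 - 1) + A 1 1 * A 1 0 * M 0 1 +
      (- A 0 1) * A 0 0 * M 1 0 + (- A 0 1) * A 1 0 * (M 1 1 - 1).
      by rewrite !SL2_mulE !SL2_invE; ring: D.
    by apply: bd; rewrite ?normrN.
  - have -> : SL2_mul (SL2_mul (SL2_inv A) M) A 0 1 =
      A 1 1 * A 0 1 * (M 0 0 - 1) + A 1 1 * A 1 1 * M 0 1 +
      (- A 0 1) * A 0 1 * M 1 0 + (- A 0 1) * A 1 1 * (M 1 1 - 1).
      by rewrite !SL2_mulE !SL2_invE; ring: D.
    by apply: bd; rewrite ?normrN.
  - have -> : SL2_mul (SL2_mul (SL2_inv A) M) A 1 0 =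
      (- A 1 0) * A 0 0 * (M 0 0 - 1) + (- A 1 0) * A 1 0 * M 0 1 +
      A 0 0 * A 0 0 * M 1 0 + A 0 0 * A 1 0 * (M 1 1 - 1).
      by rewrite !SL2_mulE !SL2_invE; ring: D.
    by apply: bd; rewrite ?normrN.
  - have -> : SL2_mul (SL2_mul (SL2_inv A) M) A 1 1 - 1 =
      (- A 1 0) * A 0 1 * (M 0 0 - 1) + (- A 1 0) * A 1 1 * M 0 1 +
      A 0 0 * A 0 1 * M 1 0 + A 0 0 * A 1 1 * (M 1 1 - 1).
      by rewrite !SL2_mulE !SL2_invE; ring: D.
    by apply: bd; rewrite ?normrN.
have -> : M = SL2_mul (SL2_mul A (SL2_mul (SL2_mul (SL2_inv A) M) A)) (SL2_inv A).
  by rewrite conj_cancel.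
by rewrite C1; apply/val_inj; rewrite /= mulr1 mulrV ?unit_SL2.
Qed.

End matrix_groups.

(** * Normalization of the cusp *)

Section normalization.
Variable R : realType.
Local Notation plane := (measurableTypeR R * measurableTypeR R)%type.
Local Notation upper := (@upper R).
Implicit Types (G : set (PSL2 R)) (M N A : SL2 R) (g : PSL2 R).

Definition conjugate G g0 : set (PSL2 R) := [set (g0 * g * g0^-1)%g | g in G].

Lemma conjugate_subgroup G g0 : subgroup G -> subgroup (conjugate G g0).
Proof.
move=> [G1 GM GV]; split.
- by exists 1%g => //; rewrite mulg1 mulgV.
- move=> _ _ [g Gg <-] [h Gh <-]; exists (g * h)%g; first exact: GM.
  by rewrite !mulgA mulgVK.
- move=> _ [g Gg <-]; exists (g^-1)%g; first exact: GV.
  by rewrite !invgM invgK mulgA.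
Qed.

Lemma matrix_group_conjugate G g0 : matrix_group (conjugate G g0) =
  [set M | matrix_group G (SL2_mul (SL2_mul (SL2_inv (repr g0)) M) (repr g0))].
Proof.
set A := repr g0.
have gA : g0 = \pi_(PSL2 R) A by rewrite reprK.
have E M : \pi_(PSL2 R) (SL2_mul (SL2_mul (SL2_inv A) M) A) =
    (g0^-1 * \pi_(PSL2 R) M * g0)%g.
  by rewrite gA -!PSL2_mul_pi -PSL2_inv_pi.
apply/seteqP; split=> M; rewrite /matrix_group/= E.
  by move=> [g Gg <-]; rewrite -!mulgA mulKg mulVg mulg1.
move=> Gg; exists (g0^-1 * \pi_(PSL2 R) M * g0)%g => //.
by rewrite -!mulgA mulVKg mulgV mulg1.
Qed.

Lemma conjugate_fundamental_domain G g0 : finite_coarea G ->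
  exists F : set plane, [/\ measurable F, F `<=` upper, (area F < +oo)%E &
    forall p, upper p -> exists2 M, matrix_group (conjugate G g0) M & F (mobius M p)].
Proof.
move=> [D [mD Dcov _] Doo]; set A := repr g0.
pose F0 : set plane := @UHP_pt R @` D.
have F0up : F0 `<=` upper by move=> _ [z _ <-]; exact: UHP_gt0b.
pose F := upper `&` mobius (SL2_inv A) @^-1` F0.
exists F; split.
- exact: measurable_mobius_preimage.
- by move=> p [].
- by rewrite mobius_area.
move=> p p0; have p0' : upper (mobius (SL2_inv A) p) by exact: mobius_upper.
have [g Gg Dg] := Dcov (MkUHP p0').
pose M := SL2_mul (SL2_mul A (repr g)) (SL2_inv A).
exists M.
  by rewrite matrix_group_conjugate /= conj_cancelV /matrix_group/= reprK.
have upg : upper (mobius (repr g) (mobius (SL2_inv A) p)) by exact: mobius_upper.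
have ME : mobius M p = mobius A (mobius (repr g) (mobius (SL2_inv A) p)).
  by rewrite (mobius_mul _ _ p0) (mobius_mul _ _ p0').
split; first by rewrite ME; exact: mobius_upper.
rewrite /preimage/= ME (mobiusK _ upg).
by exists (PSL2_act g (MkUHP p0')).
Qed.

(** Homogeneous coordinates of a boundary point. *)
Definition boundary_vector (x : option R) : R * R := if x is Some t then (t, 1) else (1, 0).

Lemma boundary_vector_neq0 x : boundary_vector x != 0.
Proof. by case: x => [t|]; rewrite xpair_eqE ?oner_eq0 ?andbF. Qed.

Lemma moebius_bd_infty M x : moebius_bd M x = None -> (act M (boundary_vector x)).2 = 0.
Proof.
case: x => [t|] /=; rewrite ?mulr1 ?mulr0 ?addr0; by case: eqP.
Qed.

Lemma moebius_bd_fixed M x : moebius_bd M x = x ->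
  wedge (act M (boundary_vector x)) (boundary_vector x) = 0.
Proof.
case: x => [t|] /=; rewrite /wedge /= ?mulr1 ?mulr0 ?addr0.
  case: eqP => // /eqP d0 [e].
  have -> : M 0 0 * t + M 0 1 = t * (M 1 0 * t + M 1 1) 
    by move/(congr1 ( *%R^~ (M 1 0 * t + M 1 1))): e; rewrite /= mulfVK.
  by ring.
by case: eqP => // -> _; rewrite ?mul0r ?subr0 ?oppr0.
Qed.

Lemma matrix_group_opp G M N : matrix_group G M ->
  (forall i j, N i j = - M i j) -> matrix_group G N.
Proof.
move=> GM e; rewrite /matrix_group/=; suff -> : \pi_(PSL2 R) N = \pi_(PSL2 R) M by [].
apply/PSL2_piP; rewrite /SL2_pm; apply/orP; right; apply/eqP/matrixP => i j.
by rewrite e mxE.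
Qed.

(** A parabolic element fixing infinity has equal diagonal entries 1 or -1;
    its upper right entry is non-zero because the element is non-trivial. *)
Lemma cusp_translation G (e : option R) g0 : cusp G e -> PSL2_bd g0 e = None ->
  exists2 tau, tau != 0 & has_translation (matrix_group (conjugate G g0)) tau.
Proof.
move=> [g [Gg g1 par fix_]] inf; set A := repr g0.
set P := repr g in par fix_.
pose N := SL2_mul (SL2_mul A P) (SL2_inv A).
have GN : matrix_group (conjugate G g0) N.
  by rewrite matrix_group_conjugate /= conj_cancelV /matrix_group/= reprK.
have A2 := moebius_bd_infty inf.
set e' := boundary_vector e in A2.
have lam0 : (act A e').1 != 0.
  apply: contra_neqN (boundary_vector_neq0 e) => /eqP l0.
  rewrite -/e' -(actK A e') [act A e']surjective_pairing l0 A2 /act/= !mulr0 !addr0.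
  by [].
have actAe : act A e' = ((act A e').1, 0) by rewrite {1}[act A e']surjective_pairing A2.
have N10 : N 1 0 = 0.
  have : wedge (act A (act P e')) (act A e') = 0 by rewrite wedge_act moebius_bd_fixed.
  have -> : act A (act P e') = act N (act A e') by rewrite /N !act_mul actK.
  rewrite actAe; set lam := (act A e').1 in lam0 *.
  rewrite /wedge /act /= !mulr0 !addr0 sub0r => /eqP.
  by rewrite oppr_eq0 !mulf_eq0 (negPf lam0) !orbF => /eqP.
have trN : N 0 0 + N 1 1 = P 0 0 + P 1 1.
  have D : A 0 0 * A 1 1 = 1 + A 0 1 * A 1 0 by rewrite -(det_SL2E A); ring.
  by rewrite /N !SL2_mulE !SL2_invE; ring: D.
have PE : P = SL2_mul (SL2_mul (SL2_inv A) N) A by rewrite conj_cancelV.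
clearbody N.
have trP : `|P 0 0 + P 1 1| = 2.
  rewrite -par; congr `|_|; rewrite /mxtrace big_ord_recl big_ord1.
  by congr (_ + SL2_mx P _ _); apply/val_inj.
have ad : N 0 0 * N 1 1 = 1 by have := det_SL2E N; rewrite N10 mulr0 subr0.
have sq : (N 0 0 + N 1 1) ^+ 2 = 4.
  by rewrite trN -(real_normK (num_real _)) trP; ring.
have da : N 1 1 = N 0 0.
  have : (N 0 0 - N 1 1) ^+ 2 = 0.
    have -> : (N 0 0 - N 1 1) ^+ 2 = (N 0 0 + N 1 1) ^+ 2 - 4 * (N 0 0 * N 1 1) by ring.
    by rewrite sq ad; ring.
  by move/eqP; rewrite expf_eq0/= subr_eq0 => /eqP.
have a2 : N 0 0 ^+ 2 = 1 by rewrite expr2 -{2}da.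
have b0 : N 0 1 != 0.
  apply: contra_neq g1 => b0.
  have P1 : SL2_pm P (SL2_one R).
    have DA : A 0 0 * A 1 1 = 1 + A 0 1 * A 1 0 by rewrite -(det_SL2E A); ring.
    have /eqP := a2; rewrite sqrf_eq1 => /orP[]/eqP a1.
      apply/orP; left; apply/eqP; congr SL2_mx; rewrite PE.
      by apply: SL2_eqP; rewrite !SL2_mulE !SL2_invE !SL2_oneE N10 b0 da a1;
        split; ring: DA.
    apply/orP; right; apply/eqP/matrixP => i j; rewrite [RHS]mxE PE.
    by case: (ord2P i) (ord2P j) => -> [] ->;
      rewrite !SL2_mulE !SL2_invE !SL2_oneE N10 b0 da a1; ring: DA.
  by rewrite -[g]reprK; apply/PSL2_piP.
have /eqP := a2; rewrite sqrf_eq1 => /orP[]/eqP a1.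
  by exists (N 0 1) => //; exists N => //; split => //; rewrite da.
have h : - N 0 0 * - N 1 1 - (- N 0 1) * (- N 1 0) = 1 by rewrite N10 mulrNN ad; ring.
exists (- N 0 1); first by rewrite oppr_eq0.
exists (SL2_of h); last by split; rewrite SL2_ofE ?da ?a1 ?N10 ?opprK ?oppr0.
apply: (matrix_group_opp GN) => i j.
by case: (ord2P i) (ord2P j) => -> [] ->; rewrite SL2_ofE.
Qed.

End normalization.

(** * Values of the Lagrange constant *)

Section spectrum.
Variable R : realType.
Implicit Types (g : PSL2 R) (u v : R * R).

Lemma pdist_value (alpha : R) u : u.2 != 0 ->
  pdist u (1, 0) (alpha, 1) = (u.2 ^+ 2 * `|alpha - slope u|)^-1.
Proof.
move=> u0; rewrite /pdist !wedge_infty/= normr1 mul1r wedge_limit// mulrA -expr2.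
by rewrite real_normK ?num_real.
Qed.

(** The inequality defining the Lagrange constant says that the height at the
    cusp u exceeds k. *)
Lemma approximation_value (alpha k : R) u : 0 < k -> u.2 != 0 ->
  wedge (alpha, 1) u != 0 ->
  (`|alpha - slope u| < 1 / (k * u.2 ^+ 2)) = (k < pdist u (1, 0) (alpha, 1)).
Proof.
move=> k0 u0; rewrite -normr_gt0 wedge_limit// pmulr_rgt0 ?normr_gt0// -normr_gt0 => w0.
have u2 : 0 < u.2 ^+ 2 by rewrite exprn_even_gt0.
have ux0 : 0 < u.2 ^+ 2 * `|alpha - slope u| by rewrite mulr_gt0.
have ku0 : 0 < k * u.2 ^+ 2 by rewrite mulr_gt0.
rewrite pdist_value// -[X in _ = (k < X)]div1r ltr_pdivlMr// ltr_pdivlMr//.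
by congr (_ < _); ring.
Qed.

Lemma value_neq0 (alpha : R) u (l d : R) : d < l ->
  `|pdist u (1, 0) (alpha, 1) - l| < d -> wedge (alpha, 1) u != 0.
Proof.
move=> dl; apply: contraTneq => e; rewrite /pdist e normr0 mulr0 invr0 mulr0 sub0r normrN.
by rewrite -leNgt (le_trans (ltW dl))// ler_norm.
Qed.

Variable G : set (PSL2 R).
Local Notation V := (cusp_vectors (matrix_group G)).

Lemma bd_infty_pi (M : SL2 R) : M 1 0 != 0 ->
  PSL2_bd (\pi_(PSL2 R) M) None = Some (slope (act M (1, 0))).
Proof. by move=> c0; rewrite PSL2_bd_pi /= (negPf c0) act_infty. Qed.

Variable v : nat -> R * R.
Hypothesis vV : forall i, V (v i) /\ (v i).2 != 0.
Hypothesis vinj : forall i j, slope (v i) = slope (v j) -> i = j.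
Variable alpha : R.
Hypothesis valpha : forall i, wedge (alpha, 1) (v i) != 0.
Local Notation value u := (pdist u (1, 0) (alpha, 1)).

Lemma approximable_of_values (k : R) N : 0 < k ->
  (forall i, (N <= i)%N -> k < value (v i)) -> approximable G alpha k.
Proof.
move=> k0 kv.
have ex i : exists M, matrix_group G M /\ act M (1, 0) = v i.
  by have [[M GM e] _] := vV i; exists M.
have [M MP] := choice ex.
pose g i := \pi_(PSL2 R) (M (N + i)%N).
have M10 i : M i 1 0 != 0.
  by have [_] := MP i; rewrite act_infty => e; have [_] := vV i; rewrite -e.
have gbd i : PSL2_bd (g i) None = Some (slope (v (N + i)%N)).
  by rewrite bd_infty_pi// (MP _).2.
have ginj : injective g.
  by move=> i j /(congr1 (fun h => PSL2_bd h None)); rewrite !gbd => -[/vinj/addnI].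
exists (range g); split.
- by move=> _ [i _ <-]; exact: (MP _).1.
- rewrite (eq_finite_set (inj_card_eq (A := setT) (fun x y _ _ => @ginj x y))).
  exact: infinite_nat.
- move=> x y; rewrite !inE => -[i _ <-] [j _ <-].
  by rewrite !gbd => -[/vinj/addnI ->].
- move=> _ [i _ <-] a c.
  have [e [e0 e1 E]] := SL2_pmP (repr_piP (M (N + i)%N)).
  have vE := (MP (N + i)%N).2; rewrite act_infty in vE.
  have ae : a = e * (v (N + i)%N).1 by rewrite -vE /a /g E.
  have ce : c = e * (v (N + i)%N).2 by rewrite -vE /c /g E.
  have [_ v0] := vV (N + i)%N.
  split; first by rewrite ce mulf_neq0.
  have -> : a / c = slope (v (N + i)%N).
    by rewrite ae ce /slope; field; rewrite e0 v0.
  have -> : c ^+ 2 = (v (N + i)%N).2 ^+ 2 by rewrite ce exprMn e1 mul1r.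
  by rewrite approximation_value// kv// leq_addr.
Qed.

(** The cusps of height above k, hence above B, are among the v i, and only
    finitely many of them have i < N. *)
Lemma values_of_approximable (B k : R) :
  (forall u, V u -> u.2 != 0 -> (exists i, wedge u (v i) = 0) \/
        wedge (alpha, 1) u != 0 /\ pdist u (1, 0) (alpha, 1) <= B) ->
  (forall u w, V u -> V w -> wedge u w = 0 -> u = w \/ u = (- w.1, - w.2)) ->
  approximable G alpha k -> 0 < k -> B < k ->
  forall N, exists2 i, (N <= i)%N & k < value (v i).
Proof.
move=> other par [S [SG Sinf Sinj Sapp]] k0 Bk N; apply: contrapT => no.
have le i : k < value (v i) -> (i < N)%N.
  by move=> kv; rewrite ltnNge; apply/negP => Ni; apply: no; exists i.
have sub : (fun g => PSL2_bd g None) @` S `<=`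
    (fun i => Some (slope (v i))) @` `I_N.
  move=> _ [g Sg <-]; have [c0 ac] := Sapp g Sg.
  have gE : g = \pi_(PSL2 R) (repr g) by rewrite reprK.
  have Vu : V (act (repr g) (1, 0)).
    by exists (repr g) => //; rewrite /matrix_group/= -gE; exact: SG.
  have u2 : (act (repr g) (1, 0)).2 != 0 by rewrite act_infty.
  have ac' : `|alpha - slope (act (repr g) (1, 0))| < 1 / (k * (act (repr g) (1, 0)).2 ^+ 2).
    by rewrite act_infty.
  set u := act _ _ in Vu u2 ac'.
  have bd : PSL2_bd g None = Some (slope u) by rewrite [in LHS]gE bd_infty_pi.
  rewrite bd; have [[i ui]|[wu uB]] := other u Vu u2; last first.
    by move: ac'; rewrite approximation_value// ltNge (le_trans uB (ltW Bk)).
  have [Vi vi0] := vV i.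
  have [su wu vu] : [/\ slope u = slope (v i), wedge (alpha, 1) u != 0 & value u = value (v i)].
    have [->|->] := par _ _ Vu Vi ui; first by split.
    have ow p : wedge p (- (v i).1, - (v i).2) = - wedge p (v i) by rewrite /wedge/=; ring.
    split; last by rewrite /pdist !ow !normrN.
      by rewrite /slope /= invrN mulrNN.
    by rewrite ow oppr_eq0.
  exists i; last by rewrite su.
  by apply: le; rewrite -vu -approximation_value.
apply: Sinf; rewrite -(eq_finite_set (inj_card_eq Sinj)).
by apply: sub_finite_set sub _; exact: finite_image.
Qed.

End spectrum.

Section hall_ray.
Variable R : realType.

Lemma lagrange_constant_fin (G : set (PSL2 R)) (alpha l : R) : 0 <= l ->
  (forall k, 0 < k -> k < l -> approximable G alpha k) ->
  (forall k, 0 < k -> approximable G alpha k -> k <= l) ->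
  lagrange_constant G alpha = l%:E.
Proof.
move=> l0 lo up; apply/eqP; rewrite eq_le; apply/andP; split.
  apply: ge_ereal_sup => _ [->|[k [k0 kapp] <-]]; rewrite lee_fin//.
  exact: up.
rewrite leNgt; apply/negP => lt.
have s0 : (0 <= lagrange_constant G alpha)%E by apply: ereal_sup_ubound; left.
move: lt s0; case E : (lagrange_constant G alpha) => [s| |]//; rewrite lte_fin lee_fin => sl s0.
have kapp : approximable G alpha ((s + l) / 2) by apply: lo; lra.
have : (((s + l) / 2)%:E <= lagrange_constant G alpha)%E.
  by apply: ereal_sup_ubound; right; exists ((s + l) / 2) => //; split => //; lra.
by rewrite E lee_fin; lra.
Qed.

Lemma lagrange_constant_infty (G : set (PSL2 R)) (alpha : R) :
  (forall k, 0 < k -> approximable G alpha k) -> lagrange_constant G alpha = +oo%E.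
Proof.
move=> app; apply/eqyP => k k0; apply: ereal_sup_ubound; right.
by exists k => //; split => //; exact: app.
Qed.

Lemma eventually_invS_lt (d : R) : 0 < d ->
  exists N, forall i, (N <= i)%N -> i.+1%:R^-1 < d.
Proof.
move=> d0; exists (Num.truncn d^-1) => i Ni.
rewrite -[d]invrK ltf_pV2 ?posrE ?invr_gt0//.
by apply: lt_le_trans (truncnS_gt _) _; rewrite ler_nat ltnS.
Qed.

End hall_ray.

Theorem corollary1p6 (R : realType) (G : set (PSL2 R))
    (latG : non_uniform_lattice G) (e : option R) (cuspe : cusp G e)
    (g0 : PSL2 R) (g0e : PSL2_bd g0 e = None) :
  exists r : R, [set` `[r%:E, +oo%E]] `<=` lagrange_spectrum G g0.
Proof.
have [subG isoG coG _] := latG.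
have subG' := conjugate_subgroup g0 subG.
set G' := conjugate G g0 in subG'; pose Gam := matrix_group G'.
have Gam1 : Gam (SL2_one R) by exact: matrix_group_one.
have GamM M N : Gam M -> Gam N -> Gam (SL2_mul M N) by exact: matrix_group_mul.
have GamV M : Gam M -> Gam (SL2_inv M) by exact: matrix_group_inv.
have Gdisc : isolated_one Gam.
  rewrite /Gam /G' matrix_group_conjugate; apply: conj_isolated_one.
  exact: matrix_group_isolated_one.
have [tau tau0 Gtau] := cusp_translation cuspe g0e.
have [c0 c00 Ggap] := lower_left_gap Gam1 GamM GamV Gdisc tau0 Gtau.
have Gstab := stabilizer_square GamM GamV Gdisc tau0 Gtau.
have [F [mF Fup Foo Fcov]] := conjugate_fundamental_domain g0 coG.
have Gdense := cusp_dense Gam1 GamM GamV Gdisc tau0 Gtau mF Fup Foo Fcov.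
have par := parallel_cusp_vectors GamM GamV Gstab.
pose B := 4 / (c0 / 288) + (2 + `|tau|).
have B2 : 2 <= B.
  have k0 : 0 <= c0 / 288 := divr_ge0 (ltW c00) (ler0n R 288).
  have : 0 <= 4 / (c0 / 288) := divr_ge0 (ler0n R 4) k0.
  by have := normr_ge0 tau; rewrite /B; lra.
have inv1 (i : nat) : i.+1%:R^-1 <= 1 :> R by rewrite invf_le1 ?ler1n.
exists (B + 1) => y; rewrite /= in_itv/= leey andbT => By.
case: y By => [l| |//]; rewrite ?lee_fin => Bl.
  have l2 : 2 <= l by lra.
  have [alpha [v [vV vinj val other]]] :=
    prescribed_values Gam1 GamM GamV c00 Ggap tau0 Gtau Gdense (fun=> l2) Gstab.
  have valpha i : wedge (alpha, 1) (v i) != 0.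
    apply: (@value_neq0 _ _ _ l i.+1%:R^-1) (val i).
    by apply: le_lt_trans (inv1 i) _; lra.
  exists alpha => //; apply: lagrange_constant_fin; first lra.
    move=> k k0 kl; have [|N HN] := @eventually_invS_lt R (l - k); first lra.
    apply: (approximable_of_values vV vinj valpha k0 (N := N)) => i /HN iN.
    move: (val i) iN; move: (_^-1) => d; rewrite ltr_norml => /andP[a _] b.
    by move: a; move: (pdist _ _ _) => p; lra.
  move=> k k0 kapp; rewrite leNgt; apply/negP => lk.
  have [|N HN] := @eventually_invS_lt R (k - l); first lra.
  have [|i /HN iN kv] := values_of_approximable vV valpha other par kapp k0 _ N.
    by rewrite -/B; lra.
  move: (val i) iN kv; move: (_^-1) => d; rewrite ltr_norml => /andP[_ a] b.
  by move: a; move: (pdist _ _ _) => p; lra.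
have l2 (i : nat) : 2 <= B + 2 + i%:R by have := ler0n R i; lra.
have [alpha [v [vV vinj val other]]] :=
  prescribed_values Gam1 GamM GamV c00 Ggap tau0 Gtau Gdense l2 Gstab.
exists alpha => //; apply: lagrange_constant_infty => k k0.
have valpha i : wedge (alpha, 1) (v i) != 0.
  apply: (@value_neq0 _ _ _ (B + 2 + i%:R) i.+1%:R^-1) (val i).
  by apply: le_lt_trans (inv1 i) _; have := ler0n R i; lra.
apply: (approximable_of_values vV vinj valpha k0 (N := Num.truncn k)) => i ki.
have : k < i%:R + 1.
  by rewrite natr1; apply: lt_le_trans (truncnS_gt _) _; rewrite ler_nat ltnS.
move: (val i) (inv1 i); move: (_^-1) => d; rewrite ltr_norml => /andP[a _] b.
by move: a; move: (pdist _ _ _) => p; lra.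
Qed.
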